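(* Let $a,b,n$ be positive integers with $a\leqslant b$ and $a\leqslant\lfloor n/2\rfloor$, and put $$f(a,b)=\left\lfloor\frac{an-1}{a+b}\right\rfloor\left(n-\left\lfloor\frac{an-1}{a+b}\right\rfloor\right).$$ Let $G$ be a bipartite graph of order $n$ containing no $[a,b]$-factor, and let $D^*=D(a-1,\lceil n/2\rceil-a;\lfloor n/2\rfloor,1)$. (i) If $\rho(D^* )<\sqrt{f(a,b)}$, then $\rho(G)\leqslant\sqrt{f(a,b)}$ with equality if and only if $G\cong K_{\lfloor\frac{an-1}{a+b}\rfloor,\,n-\lfloor\frac{an-1}{a+b}\rfloor}$. (ii) If $\rho(D^* )=\sqrt{f(a,b)}$, then $\rho(G)\leqslant\sqrt{f(a,b)}$ with equality if and only if $G\cong K_{\lfloor\frac{an-1}{a+b}\rfloor,\,n-\lfloor\frac{an-1}{a+b}\rfloor}$ or $G\cong D^*$. (iii) If $\rho(D^* )>\sqrt{f(a,b)}$, then $\rho(G)\leqslant \rho(D^* )$ with equality if and only if $G\cong D^*$.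
   Context: For positive integers $a\leqslant b$, an $[a,b]$-factor of a graph $G$ is a spanning subgraph $F$ with $a\leqslant d_F(v)\leqslant b$ for all $v$. $\rho(G)$ is the adjacency spectral radius. For nonnegative integers $p_1,p_2,q_1,q_2$, $D(p_1,p_2;q_1,q_2)$ denotes the bipartite graph with parts $X=X_1\cup X_2$, $Y=Y_1\cup Y_2$ (disjoint), $|X_i|=p_i$, $|Y_i|=q_i$, in which every vertex of $X_1$ is adjacent to every vertex of $Y_1\cup Y_2$, every vertex of $X_2$ is adjacent to every vertex of $Y_1$, and there are no other edges. *)

(* Defs.v *)
From HB Require Import structures.
From mathcomp Require Import all_boot all_order all_algebra.
From mathcomp Require Import classical_sets reals.
From mathcomp Require Import complex.

Set Implicit Arguments.
Unset Strict Implicit.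
Unset Printing Implicit Defensive.

Import Order.TTheory GRing.Theory Num.Theory.
Local Open Scope ring_scope.

Record sgraph := SGraph {
  vertex :> finType;
  adj : rel vertex;
  adj_sym : symmetric adj;
  adj_irr : irreflexive adj }.

Definition isomorphic (G H : sgraph) : Prop :=
  exists2 f : G -> H, bijective f & forall x y : G, adj (f x) (f y) = adj x y.

(* Either colour class may be empty, as happens for K_{0,n}. *)
Definition bipartite (G : sgraph) : Prop :=
  exists c : G -> bool, forall x y : G, adj x y -> c x != c y.

(* A spanning subgraph of G is given by its adjacency relation F on the
   vertices of G; irreflexivity of F follows from that of adj. *)
Definition is_factor (a b : nat) (G : sgraph) (F : rel G) : Prop :=
  [/\ symmetric F,
      subrel F (@adj G)
    & forall v : G, (a <= #|[set w | F v w]| <= b)%N].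

Definition has_factor (a b : nat) (G : sgraph) : Prop :=
  exists F : rel G, is_factor a b F.

Definition adjmx (K : nzRingType) (G : sgraph) : 'M[K]_#|G| :=
  \matrix_(i, j) (adj (enum_val i) (enum_val j))%:R.

(* The set below is finite, and nonempty as soon as G has a vertex, so that the
   supremum is then a maximum. *)
Definition spectral_radius (R : realType) (G : sgraph) : R :=
  sup [set Normc.normc z | z in [set z : R[i] | eigenvalue (adjmx R[i] G) z]]%classic.

Section BipartiteGraphs.

Variables p q p1 p2 q1 q2 : nat.

Definition Kbip_adj : rel ('I_p + 'I_q) := fun x y =>
  match x, y with
  | inl _, inr _ | inr _, inl _ => true
  | _, _ => false
  end.

Lemma Kbip_adj_sym : symmetric Kbip_adj.
Proof. by case=> ? [] ?. Qed.

Lemma Kbip_adj_irr : irreflexive Kbip_adj.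
Proof. by case. Qed.

Definition Kbip := SGraph Kbip_adj_sym Kbip_adj_irr.

(* X_1, X_2, Y_1, Y_2 are the summands, in this order. *)
Definition Dbip_adj : rel (('I_p1 + 'I_p2) + ('I_q1 + 'I_q2)) := fun x y =>
  match x, y with
  | inl (inl _), inr _ | inr _, inl (inl _) => true
  | inl (inr _), inr (inl _) | inr (inl _), inl (inr _) => true
  | _, _ => false
  end.

Lemma Dbip_adj_sym : symmetric Dbip_adj.
Proof. by move=> [[?|?]|[?|?]] [[?|?]|[?|?]]. Qed.

Lemma Dbip_adj_irr : irreflexive Dbip_adj.
Proof. by move=> [[?|?]|[?|?]]. Qed.

Definition Dbip := SGraph Dbip_adj_sym Dbip_adj_irr.

End BipartiteGraphs.

Definition sab (a b n : nat) : nat := ((a * n - 1) %/ (a + b))%N.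

Definition fab (a b n : nat) : nat := (sab a b n * (n - sab a b n))%N.

Definition Kstar (a b n : nat) : sgraph := Kbip (sab a b n) (n - sab a b n).

(* n./2 is the floor and uphalf n the ceiling of n/2. *)
Definition Dstar (a n : nat) : sgraph := Dbip (a - 1) (uphalf n - a) n./2 1.

(* Main.v *)
Require Import Defs.
From mathcomp Require Import classical_sets reals complex.
From mathcomp Require Import all_boot all_order all_algebra.
From mathcomp Require Import zify ring lra.
Import Order.TTheory GRing.Theory Num.Theory.
Set Implicit Arguments.
Unset Strict Implicit.
Unset Printing Implicit Defensive.
Local Open Scope ring_scope.

(** If a bipartite graph G with parts X, Y has no [a,b]-factor, then (after
    possibly exchanging X and Y) there are S in X and T in Y with
    b|S| + e(X \ S, T) < a|T|: maximise a partial factor along alternating paths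
    and take S, T to be the vertices reachable from a deficient vertex.

    If |T| <= b, then S may be taken empty, so that some vertex has degree less
    than a and G is a subgraph of some D(a-1, x-a+1; n-1-x, 1).  The squared
    spectral radius of the latter is the largest root of a quadratic, which is
    maximal at Dstar; in the extremal case, pairing a positive eigenvector of Dstar
    with the absolute values of an eigenvector of G forces G = Dstar.

    If |T| > b, then the certificate bounds the number e(G) of edges by
    max(f(a,b), rho(Dstar)^2), and rho(G)^2 <= e(G) with equality only if G is
    complete bipartite up to isolated vertices.  Equality thus leads back to a
    vertex of degree less than a, or to a complete bipartite graph without
    [a,b]-factor, which is K_{k,n-k} with (a+b)k < an.

    Colour [false] is X and colour [true] is Y throughout. *)

(** * Factors and alternating paths *)

Section Factors.

Variable G : sgraph.
Implicit Types (F : rel G) (c : G -> bool) (u v w : G) (a b : nat).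

Definition proper_colouring c := forall x y : G, adj x y -> c x != c y.

Definition nbrs v : {set G} := [set w | adj v w].

Definition degree F v : nat := #|[set w | F v w]|.

Definition deficiency a F := (\sum_v (a - degree F v))%N.

Lemma degreeE F v : degree F v = (\sum_w F v w)%N.
Proof. by rewrite /degree cardsE -sum1_card big_mkcond. Qed.

Definition flip F u v : rel G :=
  fun x y => F x y (+) ((x == u) && (y == v) || (x == v) && (y == u)).

Lemma flip_sym F u v : symmetric F -> symmetric (flip F u v).
Proof.
move=> symF x y; rewrite /flip symF; congr (_ (+) _).
by rewrite orbC; congr (_ || _); rewrite andbC.
Qed.

Lemma flip_degree F u v w : symmetric F -> u != v ->
  (degree (flip F u v) w)%:Z =
  (degree F w)%:Z + (-1) ^+ F u v * ((w == u) + (w == v))%N%:Z.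
Proof.
move=> symF neq_uv.
have flipE x y : x != y -> F x y = F u v ->
    (forall z, flip F u v x z = F x z (+) (z == y)) ->
    (degree (flip F u v) x)%:Z = (degree F x)%:Z + (-1) ^+ F u v.
  move=> neq_xy eqF eqflip; rewrite !degreeE (bigD1 y) //= [in RHS](bigD1 y) //=.
  rewrite eqflip eqxx eqF addbT.
  under eq_bigr => z neq_zy do rewrite eqflip (negPf neq_zy) addbF.
  case: (F u v) => /=; lia.
have [->|neq_wu] := eqVneq w u.
  rewrite (negPf neq_uv) mulr1; apply: (flipE u v) => // z.
  by rewrite /flip eqxx (negPf neq_uv) orbF.
have [->|neq_wv] := eqVneq w v.
  rewrite mulr1; apply: (flipE v u); rewrite 1?eq_sym ?[F v u]symF // => z.
  by rewrite /flip eqxx [v == u]eq_sym (negPf neq_uv).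
rewrite mulr0 addr0; congr (Posz _); rewrite !degreeE; apply: eq_bigr => z _.
by rewrite /flip (negPf neq_wu) (negPf neq_wv) addbF.
Qed.

Section AlternatingPaths.

Variable c : G -> bool.
Hypothesis proper_c : proper_colouring c.

(** Steps leave colour [true] along edges outside [F] and colour [false] along edges of [F];
    adjacent colours differ, so a path alternates. *)
Definition alternating F : rel G :=
  fun x y => adj x y && (F x y == ~~ c x).

Definition csign v : int := if c v then 1 else -1.

(** Induction flips the tail first and then the first edge, and the two changes at an inner vertex
    cancel. The agreement of [F'] with [F] on pairs not contained in the path keeps the status of
    the first edge intact until it is flipped. *)
Lemma flip_path F v p : symmetric F -> subrel F (@adj G) ->
    path (alternating F) v p -> uniq (v :: p) ->
  exists F', [/\ symmetric F', subrel F' (@adj G),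
      forall x y, ~~ ((x \in v :: p) && (y \in v :: p)) -> F' x y = F x y
    & forall w, (degree F' w)%:Z =
        (degree F w)%:Z + csign v *+ (w == v) - csign (last v p) *+ (w == last v p)].
Proof.
move=> symF subF; elim: p v => [|u p IHp] v /=.
  by exists F; split=> // w; rewrite addrK.
case/andP=> /andP[adj_vu altF] path_p /andP[v_notin uniq_p].
have [F' [symF' subF' eqF' degF']] := IHp u path_p uniq_p.
have neq_vu : v != u by apply: contraNneq v_notin => ->; exact: mem_head.
exists (flip F' v u); split.
- exact: flip_sym.
- move=> x y; rewrite /flip; case: (boolP (_ || _)) => [|_]; last first.
    by rewrite addbF; exact: subF'.
  by case/orP=> /andP[/eqP-> /eqP->] _; rewrite // adj_sym.
- move=> x y notin_xy; rewrite /flip eqF'; last first.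
    apply: contra notin_xy => /andP[x_in y_in].
    by rewrite [x \in _]inE [y \in _]inE x_in y_in !orbT.
  suff /negPf-> : ~~ ((x == v) && (y == u) || (x == u) && (y == v)).
    by rewrite addbF.
  by apply: contra notin_xy => /orP[]/andP[/eqP-> /eqP->]; rewrite !inE !eqxx ?orbT.
move=> w; rewrite flip_degree // degF' eqF' ?(eqP altF); last first.
  by rewrite (negPf v_notin).
have := proper_c adj_vu; rewrite /csign; move: (_ *+ (w == last u p)) => z.
by case: (c v); case: (c u) => //= _; case: (w == v); case: (w == u) => /=; ring.
Qed.

End AlternatingPaths.

Definition partial_factor b F :=
  [/\ symmetric F, subrel F (@adj G) & forall v, (degree F v <= b)%N].

(** A violated cut condition: [T] asks for at least [a * #|T|] factor edges, [S] absorbs at most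
    [b * #|S|], and the sum counts all edges from [T] that avoid [S]. The colouring is quantified
    because either part may contain [T]. *)
Definition no_factor_certificate a b := exists c (S T : {set G}),
  [/\ proper_colouring c, forall x, x \in S -> ~~ c x, forall x, x \in T -> c x
    & (b * #|S| + \sum_(v in T) #|nbrs v :\: S| < a * #|T|)%N].

(* Either an alternating path from [v0] ends in a vertex whose degree may change,
   or the vertices reachable from [v0] form a certificate. *)
Lemma augment a b F c v0 : (a <= b)%N -> proper_colouring c ->
    partial_factor b F -> c v0 -> (degree F v0 < a)%N ->
  (exists2 F', partial_factor b F' & (deficiency a F' < deficiency a F)%N) \/
  no_factor_certificate a b.
Proof.
move=> le_ab proper_c [symF subF degF] cv0 deg_v0.
pose reach := connect (alternating c F) v0.
(* Flipping the path takes an edge away from a [true] end and gives one to a [false] end, hence the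
   two conditions. *)
case: (pickP [pred w | reach w && (if c w then a < degree F w else degree F w < b)%N]).
  move=> e /andP[/connectP[p0 path_p0 ->]].
  case: (shortenP path_p0) => p path_p uniq_p _ good_e.
  have [F' [symF' subF' _ degF']] := flip_path proper_c symF subF path_p uniq_p.
  move: (last v0 p) good_e degF' => {}e good_e degF'.
  have neq_ev : e != v0.
    by apply: contraTneq good_e => ->; rewrite cv0 -leqNgt ltnW.
  left; exists F'.
    split=> // w; have := degF' w; have := degF w; rewrite /csign cv0.
    have [->|neq_w] := eqVneq w v0.
      by rewrite [v0 == e]eq_sym (negPf neq_ev); lia.
    have [->|neq_we] := eqVneq w e; last by lia.
    by move: good_e; case: (c e); lia.
  rewrite /deficiency (bigD1 v0) //= [X in (_ < X)%N](bigD1 v0) //= -addSn.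
  apply: leq_add.
    have := degF' v0; rewrite eqxx [v0 == e]eq_sym (negPf neq_ev) /csign cv0; lia.
  apply: leq_sum => w neq_wv; have := degF' w; rewrite (negPf neq_wv) /csign.
  have [->|neq_we] := eqVneq w e; last by lia.
  by move: good_e; case: (c e); lia.
move=> no_aug; right.
pose S := [set w | reach w && ~~ c w]; pose T := [set w | reach w && c w].
have inT v : v \in T -> (degree F v <= a)%N.
  rewrite inE => /andP[rv cv]; have := no_aug v.
  by rewrite /= rv cv /= ltnNge => /negbFE.
have inS v : v \in S -> (b <= degree F v)%N.
  rewrite inE => /andP[rv /negPf cv]; have := no_aug v.
  by rewrite /= rv cv /= ltnNge => /negbFE.
have v0T : v0 \in T by rewrite inE cv0 /reach connect0.
exists c, S, T; split=> //; try by move=> x; rewrite inE => /andP[].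
(* Strictness comes from [v0], whose degree is less than [a]. *)
apply: (@leq_ltn_trans (\sum_(v in T) degree F v)%N); last first.
  rewrite mulnC -sum_nat_const (bigD1 v0) //= [X in (_ < X)%N](bigD1 v0) //= -addSn.
  by apply: leq_add => //; apply: leq_sum => v /andP[/inT].
have splitF v : v \in T ->
    ((\sum_(z in S) F v z) + #|nbrs v :\: S| <= degree F v)%N.
  move=> vT.
  (* An edge leaving [T] outside [F] could be followed, so its other end would be in [S]. *)
  have closed z : z \notin S -> adj v z -> F v z.
    move=> zS adj_vz; apply: contraNT zS => nFvz.
    move: vT; rewrite !inE => /andP[rv cv].
    have -> : ~~ c z by have := proper_c _ _ adj_vz; rewrite cv; case: (c z).
    rewrite andbT; apply: connect_trans rv (connect1 _).
    by rewrite /alternating adj_vz cv (negPf nFvz).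
  rewrite degreeE [X in (_ <= X)%N](bigID (mem S)) /= leq_add2l.
  rewrite -sum1_card big_mkcond [X in (_ <= X)%N]big_mkcond /=.
  apply: leq_sum => z _; rewrite in_setD [z \in nbrs v]in_set.
  have [|/closed] := boolP (z \in S) => //=.
  by case: (adj v z) => // ->.
apply: (@leq_trans (\sum_(v in T) (\sum_(z in S) F v z + #|nbrs v :\: S|))%N);
  last exact: leq_sum.
rewrite big_split /= leq_add2r exchange_big /=.
rewrite mulnC -sum_nat_const; apply: leq_sum => z zS; apply: leq_trans (inS z zS) _.
(* Edges of [F] at a vertex of [S] can be followed, so all of them end in [T]. *)
rewrite degreeE [X in (X <= _)%N](bigID (mem T)) /= -[X in (_ <= X)%N]addn0.
apply: leq_add; first by apply: leq_sum => v _; rewrite symF.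
rewrite big1 // => v vT; apply/eqP; rewrite eqb0; apply: contra vT => Fzv.
move: zS; rewrite !inE => /andP[rz ncz].
apply/andP; split.
  apply: connect_trans rz (connect1 _).
  by rewrite /alternating (subF _ _ Fzv) Fzv ncz.
by have := proper_c _ _ (subF _ _ Fzv); move: ncz; case: (c z); case: (c v).
Qed.

(** Augmentation starts from the empty factor and lowers the total deficiency; the colours are
    exchanged when needed to make the deficient vertex [true]. *)
Lemma factor_or_certificate a b : (a <= b)%N -> bipartite G ->
  has_factor a b G \/ no_factor_certificate a b.
Proof.
move=> le_ab [c0 proper0].
suff IH k F : partial_factor b F -> (deficiency a F <= k)%N ->
    has_factor a b G \/ no_factor_certificate a b.
  apply: (IH _ (fun _ _ => false)) (leqnn _); split=> // v.
  by rewrite /degree (_ : [set w | _] = set0) ?cards0 //; apply/setP=> w; rewrite !inE.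
elim: k F => [|k IHk] F pF def_k.
  left; exists F; have [symF subF degF] := pF; split=> // v.
  move: def_k; rewrite leqn0 sum_nat_eq0 => /forallP/(_ v)/=.
  by rewrite subn_eq0 => le_a; apply/andP; split=> //; exact: degF.
case: (pickP (fun v => degree F v < a)%N) => [v0 deg_v0|no_def]; last first.
  left; exists F; have [symF subF degF] := pF; split=> // v.
  by apply/andP; split; [rewrite leqNgt; exact: negbT (no_def v) | exact: degF].
have proper_c : proper_colouring (fun w => c0 w == c0 v0).
  by move=> x y /proper0; case: (c0 x); case: (c0 y); case: (c0 v0).
have [|[F' pF' lt_def]|] := augment le_ab proper_c pF _ deg_v0; rewrite ?eqxx //.
  by apply: (IHk F') => //; rewrite -ltnS (leq_trans lt_def).
by right.
Qed.

End Factors.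

(** * The edge bound *)

Section EdgeArithmetic.

Local Open Scope nat_scope.


(* [half_pred n] and [n./2] are the floor and the ceiling of [(n - 1) / 2]: the
   sizes of the parts of Dstar without its vertex of degree [a - 1]. *)
Definition half_pred n := (uphalf n - 1)%N.

Lemma half_pred_bounds a n : 0 < a -> a <= n./2 ->
  [/\ a - 1 < n./2, half_pred n <= n./2 <= (half_pred n).+1
    & (half_pred n + n./2).+1 = n].
Proof. by rewrite /half_pred; split; lia. Qed.

Lemma sabP a b n : 0 < a -> 0 < n ->
  (a + b) * sab a b n < a * n <= (a + b) * (sab a b n).+1.
Proof.
move=> a_gt0 n_gt0; have an_gt0 : 0 < a * n by rewrite muln_gt0 a_gt0.
have ab_gt0 : 0 < a + b by rewrite addn_gt0 a_gt0.
have := divn_eq (a * n - 1) (a + b); have := ltn_pmod (a * n - 1) ab_gt0.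
rewrite /sab; move: (divn _ _) (modn _ _) => k r; nia.
Qed.

Lemma le_sab a b n k : 0 < a -> 0 < n -> (a + b) * k < a * n -> k <= sab a b n.
Proof.
move=> a_gt0 n_gt0 lt_k; have /andP[_] := sabP b a_gt0 n_gt0.
by move/(leq_trans lt_k); rewrite ltn_pmul2l ?addn_gt0 ?a_gt0.
Qed.

Lemma sab_lt_half a b n : 0 < a -> 0 < n -> a <= b -> (sab a b n).*2 < n.
Proof.
move=> a_gt0 n_gt0 le_ab; have /andP[+ _] := sabP b a_gt0 n_gt0.
move: (sab a b n) => k; nia.
Qed.

(** [k * (n - k)] increases strictly up to [n / 2], and the largest admissible [k], namely [sab],
    lies below [n / 2]. *)
Lemma fab_max a b n k : 0 < a -> 0 < n -> a <= b -> (a + b) * k < a * n ->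
  k * (n - k) <= fab a b n ?= iff (k == sab a b n).
Proof.
move=> a_gt0 n_gt0 le_ab lt_k; have := sab_lt_half a_gt0 n_gt0 le_ab.
have := le_sab a_gt0 n_gt0 lt_k; rewrite /fab.
move: (sab a b n) => m le_km lt_m; split; first by nia.
apply/eqP/eqP => [|->//]; nia.
Qed.

Lemma le_half_pred_prod n e : 4 * e <= (n - 1) ^ 2 -> e <= half_pred n * n./2.
Proof.
rewrite /half_pred uphalf_half; have := odd_double_half n.
move: (n./2) => k; case: (odd n) => /=; nia.
Qed.

(* With [h = d./2] and [h' = uphalf d], this is [e <= g + (a - 1)^2 / x] for
   [x = s + h], [g = x * (s + h')] and [e = s * (s + d) + r]. *)
Lemma excess_bound a c s h h' r : 0 < a -> h <= h' <= h.+1 ->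
    r < a + c -> s < r -> c.+2 <= h + h' -> a * (h + h' - c.+1) <= c * (c - 1) ->
  (s + h) * r <= h * h' * (s + h) + (a - 1) ^ 2.
Proof.
move=> a_gt0 /andP[le_h le_h'] lt_r lt_s le_c le_a.
have [le_r|lt_hr] := leqP r (h * h').
  by rewrite mulnC; apply: leq_trans (leq_addr _ _); rewrite leq_mul2r le_r orbT.
(* With [u] the excess of [r] over [h * h'], AM-GM reduces the claim to [s + h + u <= 2 * (a - 1)],
   except for small [h] and [h']. *)
have [u Er] : exists u, r = h * h' + u by exists (r - h * h'); rewrite subnKC // ltnW.
suff: (s + h) * u <= (a - 1) ^ 2 by rewrite Er mulnDr [h * h' * _]mulnC leq_add2l.
have AMGM v w m : v + w <= 2 * m -> v * w <= m ^ 2.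
  move=> le_m; rewrite -(leq_pmul2l (isT : 0 < 4)).
  apply: leq_trans (leq_of_leqif (nat_AGM2 v w)) _.
  by rewrite -[4]/(2 ^ 2) -expnMn leq_exp2r.
have [le3|lt3] := leqP 3 h.
  have [lt4|lt4] := leqP h' 3; last first.
    apply: AMGM; have [i Eh] : exists i, h = 3 + i by exists (h - 3); lia.
    have [j Eh'] : exists j, h' = 4 + j by exists (h' - 4); lia.
    (* This is [(h - 2)(h' - 3) >= 1]; with [s < r < a + c] and [c + 2 <= h + h'] it yields the sum
       needed for AM-GM. *)
    have : 3 * h + 2 * h' <= h * h' + 5.
      by rewrite Eh Eh' mulnDl !mulnDr; lia.
    lia.
  have [h3 h'3] : h = 3 /\ h' = 3 by clear -le3 lt4 le_h; lia.
  move: le_c le_a lt_hr Er; rewrite {}h3 {}h'3 => le_c le_a lt_hr Er.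
  have [c4|c_le] := eqVneq c 4.
    (* Here [(s + 3) * u <= (a + 5)(a - 6)], which stays below [(a - 1)^2] only up to [a = 31], so a
       cap on [a] is required. *)
    have : a <= 12 by move: le_a; rewrite c4; clear; lia.
    have : s <= a + 2 by lia.
    have : u + 6 <= a by lia.
    clear; nia.
  have : c <= 3 by lia.
  by case: c lt_r le_c le_a {c_le} => [|[|[|[|]]]] //= *; lia.
have : c <= 3 by lia.
have : h' <= 3 by lia.
case: h le_h le_h' le_c le_a lt_hr Er lt3 => [|[|[|//]]].
- by case: h' => [|[|[|[|]]]] //= *; lia.
- by case: h' => [|[|[|[|]]]] //=; case: c lt_r => [|[|[|[|]]]] //= *; lia.
case: h' => [|[|[|[|]]]] //=; case: c lt_r => [|[|[|[|]]]] //= *; try lia.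
have : s <= a + 1 by lia.
have : u + 4 <= a by lia.
have : a <= 6 by lia.
clear; nia.
Qed.

(* The case where [s] is the largest integer with [b * s < a * t] and
   [w = n - t - s - 1] is at most [s]. *)
Lemma edge_bound_tight a b n s t r w e : 0 < a -> a <= b -> b < t ->
    a * t = b * s + r + 1 -> r < b -> w <= s -> n = s + t + 1 + w ->
    e <= s.+1 * w + s * t + r ->
  [\/ e <= fab a b n, e <= half_pred n * n./2
    | 0 < half_pred n /\
      half_pred n * e <= half_pred n * (half_pred n * n./2) + (a - 1) ^ 2].
Proof.
move=> a_gt0 le_ab lt_bt Et lt_rb le_ws En le_e.
have n_gt0 : 0 < n by lia.
(* If [s + 1] is still admissible in [fab_max], then [r < t] gives [e <= (s + 1) * (n - s - 1)]. *)
have [le_s1|gt_s1] := leqP (s.+1 * (a + b)) (a * n - 1).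
  have an_gt0 : 0 < a * n by rewrite muln_gt0 a_gt0.
  constructor 1; have lt_s1 : (a + b) * s.+1 < a * n by rewrite mulnC; clear -le_s1 an_gt0; lia.
  apply: leq_trans (leq_of_leqif (fab_max a_gt0 n_gt0 le_ab lt_s1)).
  have -> : n - s.+1 = t + w by lia.
  rewrite mulnDr; lia.
have le_b : r.+1 + a * w <= b by move: gt_s1; rewrite En; clear -Et a_gt0; nia.
have lt_s : (a + b) * s < a * n by rewrite En; clear -Et a_gt0; nia.
have [le_wr|gt_wr] := leqP (w + r) s.
  constructor 1; apply: leq_trans (leq_of_leqif (fab_max a_gt0 n_gt0 le_ab lt_s)).
  have -> : n - s = t + w + 1 by lia.
  rewrite !mulnDr; clear -le_e le_wr; lia.
have [c Eb] : exists c, b = a + c by exists (b - a); lia.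
have [d Ed] : exists d, t = s + d.
  exists (t - s); suff: s <= t by lia.
  rewrite -(leq_pmul2l a_gt0); have := leq_mul le_ab (leqnn s); lia.
subst b t.
have Ead : a * d = c * s + r + 1 by clear -Et; lia.
have [w0|w_gt0] := posnP w; last first.
  constructor 2; apply: le_half_pred_prod.
  have lt_cd : c < d by clear -lt_bt Ead a_gt0; nia.
  have le_c : r + w <= c by clear -le_b w_gt0 a_gt0; nia.
  (* What remains of [4 * e <= (n - 1)^2] after expanding with [n - 1 = 2 * s + d + w]. *)
  have : 4 * (r + w) <= (d + w) ^ 2 by rewrite -mulnn; clear -le_c lt_cd w_gt0; nia.
  have -> : n - 1 = 2 * s + (d + w) by lia.
  rewrite -!mulnn; clear -le_e; nia.
(* Now [n - 1 = 2 * s + d], so halving [d] gives the part sizes [s + h] and [s + h']. *)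
constructor 3; subst w.
have le_cd : c.+2 <= d by clear -lt_bt Ead a_gt0 gt_wr; nia.
have le_a : a * (d - c.+1) <= c * (c - 1).
  have [i Ei] : exists i, d = c.+1 + i by exists (d - c.+1); lia.
  have le_s : s + 2 <= a + c by lia.
  have := leq_mul (leqnn c) le_s; move: Ead; rewrite Ei addKn mulnBr muln1 !mulnDr mulnS.
  by clear -le_b; lia.
have [h Eh] : exists h, h = d./2 by exists d./2.
have [h' Eh'] : exists h', h' = uphalf d by exists (uphalf d).
have hh' : d = h + h' by rewrite Eh Eh' -{1}(odd_double_half d) uphalf_half; lia.
have le_h : h <= h' <= h.+1 by rewrite Eh Eh' uphalf_half; case: (odd d); lia.
have Ex : half_pred n = s + h by rewrite /half_pred En Eh; clear; lia.
have Eq : n./2 = s + h' by rewrite En Eh'; clear; lia.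
rewrite Ex Eq; split; first by clear -gt_wr le_h hh' le_cd; lia.
have := @excess_bound a c s h h' r a_gt0 le_h.
have lt_rac : r < a + c by lia.
rewrite -hh' => /(_ lt_rac gt_wr le_cd le_a) bound.
have : e <= s * (s + d) + r by lia.
rewrite hh'; clear -bound => le_e.
apply: (@leq_trans ((s + h) * (s * (s + (h + h')) + r))); first by rewrite leq_mul2l le_e orbT.
rewrite mulnDr.
apply: (@leq_trans ((s + h) * (s * (s + (h + h'))) + (h * h' * (s + h) + (a - 1) ^ 2))).
  by rewrite leq_add2l.
by rewrite addnA leq_add2r; lia.
Qed.

(** Since [t > b], the bound on [e] grows with [s], so [s] may be raised to the largest [m] with
    [b * m < a * t]. If [m >= x], then [e <= x * y] suffices; otherwise AM-GM settles
    [x + (y - t) >= 2 * m + 2], and [edge_bound_tight] the rest. *)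
Lemma edge_bound a b n x y s t e : 0 < a -> a <= b -> x + y = n -> s <= x -> t <= y ->
    b < t -> b * s < a * t -> e <= x * y ->
    e + b * s < x * (y - t) + s * t + a * t ->
  [\/ e <= fab a b n, e <= half_pred n * n./2
    | 0 < half_pred n /\
      half_pred n * e <= half_pred n * (half_pred n * n./2) + (a - 1) ^ 2].
Proof.
move=> a_gt0 le_ab En le_sx le_ty lt_bt lt_st le_exy lt_e.
have n_gt0 : 0 < n by lia.
have [lt_x|ge_x] := ltnP (b * x) (a * t).
  constructor 1; have lt_abx : (a + b) * x < a * n by nia.
  apply: leq_trans (leq_of_leqif (fab_max a_gt0 n_gt0 le_ab lt_abx)).
  by rewrite -En addKn.
have b_gt0 : 0 < b by lia.
have Et := divn_eq (a * t - 1) b; have lt_rb := ltn_pmod (a * t - 1) b_gt0.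
move: (divn _ b) (modn _ b) Et lt_rb => m r Et lt_rb.
have {}Et : a * t = b * m + r + 1 by lia.
have lt_mx : m < x by clear -ge_x Et b_gt0; nia.
have le_sm : s <= m by clear -lt_st Et lt_rb; nia.
have [z Ez] : exists z, y = t + z by exists (y - t); lia.
subst y; rewrite addKn in lt_e.
have le_e : e <= x * z + m * t + r.
  have [k Ek] : exists k, t = b + k by exists (t - b); lia.
  have : s * k <= m * k by rewrite leq_mul2r le_sm orbT.
  move: lt_e; rewrite Et Ek !mulnDr; lia.
have [le2|lt2] := leqP (2 * m + 2) (x + z).
  constructor 2; apply: le_half_pred_prod.
  have AMGM := leq_of_leqif (nat_AGM2 x z).
  have [i Ei] : exists i, x + z = 2 * m + 2 + i by exists (x + z - (2 * m + 2)); lia.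
  have lt_mt : m < t by clear -Et le_ab lt_bt; nia.
  have [k Ek] : exists k, t = k.+2 by exists (t - 2); lia.
  have le_r : r <= k by lia.
  have -> : n - 1 = 2 * m + i + k + 3 by lia.
  move: AMGM; rewrite Ei -!mulnn => AMGM.
  have := leq_of_leqif (nat_AGM2 k 1); rewrite -mulnn.
  by clear -AMGM le_e lt_mt le_r Ek; subst t; lia.
have [w Ew] : exists w, x + z = m.+1 + w by exists (x + z - m.+1); lia.
apply: (edge_bound_tight a_gt0 le_ab lt_bt Et lt_rb (w := w)); [lia | lia |].
apply: leq_trans le_e _; rewrite !leq_add2r.
have [i Ei] : exists i, x = m.+1 + i by exists (x - m.+1); lia.
have Ew' : w = z + i by lia.
have le_zm : z + i <= m by lia.
by subst x w; clear -le_zm; nia.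
Qed.

End EdgeArithmetic.

(** * Spectral radius of a graph *)

Lemma eigenvalue_adjmxP (F : fieldType) (G : sgraph) (z : F) :
  reflect (exists2 h : G -> F, exists x, h x != 0 &
             forall y, \sum_(x | adj y x) h x = z * h y)
          (eigenvalue (adjmx F G) z).
Proof.
have sumE (v : 'rV[F]_#|G|) (y : G) :
    \sum_(x | adj y x) v 0 (enum_rank x) = (v *m adjmx F G) 0 (enum_rank y).
  rewrite mxE (reindex enum_rank) /=; last by apply: onW_bij; exact: enum_rank_bij.
  rewrite big_mkcond; apply: eq_bigr => x _; rewrite mxE !enum_rankK adj_sym.
  by case: ifP => _; rewrite (mulr1, mulr0).
apply: (iffP idP) => [/eigenvalueP[v Av v_neq0]|[h [x hx_neq0] hz]].
  exists (fun x => v 0 (enum_rank x)); last by move=> y; rewrite sumE Av mxE.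
  have /rV0Pn[i vi] := v_neq0; by exists (enum_val i); rewrite enum_valK.
apply/eigenvalueP; exists (\row_i h (enum_val i)); last first.
  by apply/rV0Pn; exists (enum_rank x); rewrite mxE enum_rankK.
apply/rowP=> j; rewrite -[j]enum_valK -sumE !mxE enum_valK -hz.
by apply: eq_bigr => y _; rewrite mxE enum_rankK.
Qed.

Lemma eigenvalue_isomorphic (F : fieldType) (G H : sgraph) (z : F) :
  isomorphic G H -> eigenvalue (adjmx F G) z = eigenvalue (adjmx F H) z.
Proof.
case=> f bij_f adj_f; have [g fK gK] := bij_f.
apply/eigenvalue_adjmxP/eigenvalue_adjmxP => -[h [x hx] hz].
  exists (h \o g) => [|y]; first by exists (f x); rewrite /= fK.
  rewrite (reindex f) /=; last by apply: onW_bij.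
  rewrite -hz; apply: eq_big => w; first by rewrite -{1}[y]gK adj_f.
  by rewrite fK.
exists (h \o f) => [|y]; first by exists (g x); rewrite /= gK.
rewrite /= -hz [RHS](reindex f) /=; last by apply: onW_bij.
by apply: eq_bigl => w; rewrite adj_f.
Qed.

Lemma spectral_radius_isomorphic (R : realType) (G H : sgraph) :
  isomorphic G H -> spectral_radius R G = spectral_radius R H.
Proof.
move=> isoGH; rewrite /spectral_radius; congr (sup [set _ | _ in _]%classic).
by apply: eq_set => z; rewrite (eigenvalue_isomorphic _ isoGH).
Qed.

(** The characteristic polynomial splits over [R[i]], so the eigenvalues form a finite nonempty list
    and the supremum is attained. *)
Lemma spectral_radiusP (R : realType) (G : sgraph) : (0 < #|G|)%N ->
  exists z : R[i], [/\ eigenvalue (adjmx R[i] G) z,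
    Normc.normc z = spectral_radius R G
    & forall y, eigenvalue (adjmx R[i] G) y -> Normc.normc y <= spectral_radius R G].
Proof.
move=> G_gt0; pose A := adjmx R[i] G.
have [rs Ers] := closed_field_poly_normal (char_poly A).
have eigE z : eigenvalue A z = (z \in rs).
  rewrite eigenvalue_root_char Ers (monicP (char_poly_monic A)) scale1r.
  by rewrite root_prod_XsubC.
have rs_neq0 : rs != [::].
  move: Ers; rewrite (monicP (char_poly_monic A)) scale1r => Ers.
  have := size_char_poly A; rewrite Ers size_prod_XsubC.
  by case: (rs) => //= -[E]; rewrite -E in G_gt0.
have [z z_rs max_z] : exists2 z, z \in rs &
    forall y, y \in rs -> Normc.normc y <= Normc.normc z.
  elim: (rs) rs_neq0 => // x s IHs _; have [->|/IHs[z zs max_z]] := eqVneq s [::].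
    by exists x => [|y]; rewrite inE // => /eqP->.
  have [le_xz|/ltW le_zx] := leP (Normc.normc x) (Normc.normc z).
    exists z => [|y]; first by rewrite inE zs orbT.
    by rewrite inE => /orP[/eqP->|/max_z].
  exists x => [|y]; first exact: mem_head.
  rewrite inE => /orP[/eqP->//|/max_z le_yz]; exact: le_trans le_zx.
have normE : spectral_radius R G = Normc.normc z.
  have ubz : ubound [set Normc.normc z | z in [set z | eigenvalue A z]]%classic (Normc.normc z).
    by move=> _ [y /= + <-]; rewrite eigE => /max_z.
  apply/le_anti/andP; split; first apply: ge_sup => //.
    by exists (Normc.normc z), z => //=; rewrite eigE.
  by apply: ub_le_sup; [exists (Normc.normc z) | exists z => //=; rewrite eigE].
by exists z; split; rewrite ?normE ?eigE // => y; rewrite eigE => /max_z.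
Qed.

Lemma normc_ge0 (R : rcfType) (z : R[i]) : 0 <= Normc.normc z.
Proof. by case: z => x y; exact: sqrtr_ge0. Qed.

Lemma normc_real (R : rcfType) (x : R) : Normc.normc (x%:C)%C = `|x|.
Proof. by rewrite /Normc.normc /= expr0n addr0 sqrtr_sqr. Qed.

Lemma normc_sum (R : rcfType) (I : Type) (s : seq I) (P : pred I) (F : I -> R[i]) :
  Normc.normc (\sum_(i <- s | P i) F i) <= \sum_(i <- s | P i) Normc.normc (F i).
Proof.
elim/big_rec2: _ => [|i y x _ le_xy]; first by rewrite Normc.normc0.
by apply: le_trans (le_normcD _ _) _; rewrite lerD2l.
Qed.

(* Satisfied by the absolute values of an eigenvector for an eigenvalue of
   modulus [r]. *)
Definition subinvariant (R : realType) (G : sgraph) (r : R) (h : G -> R) :=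
  [/\ 0 <= r, forall x, 0 <= h x, exists x, 0 < h x
    & forall y, r * h y <= \sum_(x | adj y x) h x].

(** The triangle inequality for an eigenvector of an eigenvalue of largest modulus; this stands in
    for Perron-Frobenius. *)
Lemma spectral_radius_subinvariant (R : realType) (G : sgraph) : (0 < #|G|)%N ->
  exists h, subinvariant (spectral_radius R G) (h : G -> R).
Proof.
case/(spectral_radiusP R)=> z [/eigenvalue_adjmxP[h [x hx] hz] <- _].
exists (fun x => Normc.normc (h x)); split=> [|y||y]; rewrite ?normc_ge0 //.
  exists x; rewrite lt_neqAle normc_ge0 andbT eq_sym.
  by apply: contra hx => /eqP/Normc.eq0_normc->.
by rewrite -Normc.normcM -hz normc_sum.
Qed.

Lemma spectral_radius_ge0 (R : realType) (G : sgraph) : (0 < #|G|)%N ->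
  0 <= spectral_radius R G.
Proof. by case/(spectral_radiusP R)=> z [_ <- _]; exact: normc_ge0. Qed.

Lemma le_spectral_radius (R : realType) (G : sgraph) (r : R) (h : G -> R) :
    (exists x, h x != 0) -> (forall y, \sum_(x | adj y x) h x = r * h y) ->
  r <= spectral_radius R G.
Proof.
move=> [x hx] hr; have G_gt0 : (0 < #|G|)%N by apply/card_gt0P; exists x.
have [_ [_ _ ub]] := spectral_radiusP R G_gt0.
apply: le_trans (ler_norm r) _; rewrite -normc_real; apply: ub.
apply/eigenvalue_adjmxP; exists (fun x => (h x)%:C%C) => [|y].
  by exists x; rewrite fmorph_eq0.
by rewrite -rmorph_sum hr rmorphM.
Qed.

(** * Comparison with the number of edges and with weights *)

Definition edges (G : sgraph) (c : G -> bool) : nat := (\sum_(y | c y) #|nbrs y|)%N.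

Section EdgeBound.

Variables (R : realType) (G : sgraph) (c : G -> bool) (r : R) (h : G -> R).
Hypothesis proper_c : proper_colouring c.
Hypothesis sub_h : subinvariant r h.

Let E : R := (edges c)%:R.
Let H1 := \sum_(x | ~~ c x) h x ^+ 2.
Let H2 := \sum_(y | c y) h y ^+ 2.
Let Q := \sum_(y | c y) \sum_(x | adj y x) h x * h y.
Let SQ := \sum_(y | c y) \sum_(x | adj y x) (h x * h y) ^+ 2.
Let Z := \sum_(y | c y) \sum_(x | ~~ c x && ~~ adj y x) (h x * h y) ^+ 2.
(** The Cauchy-Schwarz defect of the products [h x * h y] over the edges; it vanishes only if
    [E * (h x * h y) = Q] on every edge. *)
Let V := \sum_(y | c y) \sum_(x | adj y x) (E * (h x * h y) - Q) ^+ 2.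

Let adj_class x y : c y -> adj y x -> ~~ c x.
Proof. by move=> cy /proper_c; rewrite cy; case: (c x). Qed.

Let EE : E = \sum_(y | c y) \sum_(x | adj y x) 1.
Proof.
rewrite /E /edges natr_sum; apply: eq_bigr => y _.
by rewrite -sum1_card natr_sum; apply: eq_bigl => x; rewrite inE.
Qed.

Let SQZ : SQ + Z = H1 * H2.
Proof.
rewrite -big_split /= /H2 mulr_sumr; apply: eq_bigr => y cy.
rewrite /H1 mulr_suml [RHS](bigID (adj y)) /=; congr (_ + _).
  apply: eq_big => [x|x _]; last by rewrite exprMn.
  by case: (boolP (adj y x)) => [/(adj_class cy)->|_]; rewrite ?andbF.
by apply: eq_bigr => x _; rewrite exprMn.
Qed.

Let VE : V = E * (E * SQ - Q ^+ 2).
Proof.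
have -> : V = \sum_(y | c y) \sum_(x | adj y x)
    (E ^+ 2 * (h x * h y) ^+ 2 + (- (2 * E * Q) * (h x * h y) + Q ^+ 2 * 1)).
  by apply: eq_bigr => y _; apply: eq_bigr => x _; ring.
under eq_bigr => y _ do rewrite !big_split /= -!mulr_sumr.
by rewrite !big_split /= -!mulr_sumr -EE -/SQ -/Q; ring.
Qed.

Let V_ge0 : 0 <= V.
Proof. by apply: sumr_ge0 => y _; apply: sumr_ge0 => x _; rewrite sqr_ge0. Qed.

Let Z_ge0 : 0 <= Z.
Proof. by apply: sumr_ge0 => y _; apply: sumr_ge0 => x _; rewrite sqr_ge0. Qed.

Let H1_ge0 : 0 <= H1. Proof. by apply: sumr_ge0 => x _; rewrite sqr_ge0. Qed.
Let H2_ge0 : 0 <= H2. Proof. by apply: sumr_ge0 => x _; rewrite sqr_ge0. Qed.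

Let Q2_le : Q ^+ 2 <= E * SQ.
Proof.
have [E0|E_neq0] := eqVneq (edges c) 0%N; last first.
  have E_gt0 : 0 < E by rewrite ltr0n lt0n.
  by move: V_ge0; rewrite VE pmulr_rge0 // subr_ge0.
have -> : Q = 0.
  rewrite /Q big1 // => y cy; rewrite big_pred0 // => x; apply/negP => adj_yx.
  have : (#|nbrs y| <= edges c)%N by rewrite /edges (bigD1 y) //= leq_addr.
  by rewrite E0 leqn0 cards_eq0 => /eqP/setP/(_ x); rewrite !inE adj_yx.
by rewrite /E E0 mul0r expr0n.
Qed.

Let rH1_le : r * H1 <= Q.
Proof.
have [_ h_ge0 _ hr] := sub_h.
have -> : Q = \sum_(x | ~~ c x) (\sum_(y | adj x y) h y) * h x.
  rewrite /Q (exchange_big_dep (fun x => ~~ c x)) /=; last by move=> y x; exact: adj_class.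
  apply: eq_bigr => x cx; rewrite mulr_suml; apply: eq_big => [y|y _]; last by rewrite mulrC.
  rewrite adj_sym; case: (boolP (adj x y)) => [/proper_c|]; rewrite ?andbF // andbT.
  by move: cx; case: (c x); case: (c y).
rewrite /H1 mulr_sumr; apply: ler_sum => x _; rewrite expr2 mulrA.
by apply: ler_wpM2r.
Qed.

Let rH2_le : r * H2 <= Q.
Proof.
have [_ h_ge0 _ hr] := sub_h.
rewrite /H2 mulr_sumr /Q; apply: ler_sum => y _; rewrite expr2 mulrA -mulr_suml.
by apply: ler_wpM2r.
Qed.

Let H12_gt0 : 0 < H1 + H2.
Proof.
have [_ h_ge0 [x hx] _] := sub_h.
have -> : H1 + H2 = \sum_x h x ^+ 2 by rewrite [RHS](bigID c) addrC.
by rewrite (bigD1 x) //= ltr_wpDr ?exprn_gt0 // sumr_ge0 // => y _; rewrite sqr_ge0.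
Qed.

(** If a class had no weight, Cauchy-Schwarz would give [Q = 0], contrary to
    [r * (H1 + H2) <= 2 * Q]. *)
Let H1H2_gt0 : 0 < r -> 0 < H1 * H2.
Proof.
move=> r_gt0; rewrite lt_neqAle mulr_ge0 // andbT eq_sym; apply/eqP => H0.
have : Q ^+ 2 <= 0.
  by apply: le_trans Q2_le _; rewrite -[leRHS](mulr0 E) ler_wpM2l ?ler0n // -H0 -SQZ lerDl.
rewrite le_eqVlt ltNge sqr_ge0 orbF sqrf_eq0 => /eqP Q0.
have := mulr_gt0 r_gt0 H12_gt0; rewrite mulrDr ltNge -[0]addr0 => /negP; apply.
by apply: lerD; rewrite -Q0.
Qed.

Let r2_le : r ^+ 2 * (H1 * H2) <= Q ^+ 2.
Proof.
have [r_ge0 _ _ _] := sub_h.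
rewrite (_ : r ^+ 2 * _ = (r * H1) * (r * H2)); last by ring.
by rewrite expr2 ler_pM ?mulr_ge0.
Qed.

(** The chain is [r^2 H1 H2 <= Q^2 <= E SQ <= E H1 H2]: subinvariance summed over each class,
    Cauchy-Schwarz over the edges, and omission of the non-edges [Z]. *)
Lemma subinvariant_le_edges : r ^+ 2 <= (edges c)%:R.
Proof.
have [r_ge0 _ _ _] := sub_h; have [->|r_neq0] := eqVneq r 0; first by rewrite expr0n ler0n.
have r_gt0 : 0 < r by rewrite lt_neqAle eq_sym r_neq0.
rewrite -(ler_pM2r (H1H2_gt0 r_gt0)); apply: le_trans r2_le _; apply: le_trans Q2_le _.
by rewrite -SQZ ler_wpM2l ?ler0n // lerDl.
Qed.

(** Equality forces [V = 0] and [Z = 0]. The first makes [h] nonzero at every non-isolated vertex,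
    and the second then excludes a non-adjacent pair of such vertices across the classes. *)
Lemma subinvariant_eq_edges : 0 < r -> r ^+ 2 = (edges c)%:R ->
  forall x y, ~~ c x -> c y -> nbrs x != set0 -> nbrs y != set0 -> adj y x.
Proof.
move=> r_gt0; rewrite -/E => r2E.
have E_gt0 : 0 < E by rewrite -r2E exprn_gt0.
have HH_gt0 := H1H2_gt0 r_gt0.
have Z0 : Z = 0.
  have := le_trans r2_le Q2_le; rewrite r2E ler_pM2l // -SQZ gerDl => Z_le0.
  by apply/le_anti; rewrite Z_le0 Z_ge0.
have V0 : V = 0.
  apply/le_anti; rewrite V_ge0 andbT VE pmulr_rle0 // subr_le0.
  by apply: le_trans r2_le; rewrite r2E -SQZ Z0 addr0.
have Q_gt0 : 0 < Q.
  have : 0 < Q ^+ 2 by apply: lt_le_trans r2_le; rewrite mulr_gt0 ?exprn_gt0.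
  have : 0 <= Q by apply: le_trans rH1_le; rewrite mulr_ge0 ?(ltW r_gt0).
  by rewrite [0 <= Q]le_eqVlt => /orP[/eqP<-|//]; rewrite expr0n ltxx.
have edge_neq0 x y : c y -> adj y x -> h x * h y != 0.
  move=> cy adj_yx; apply: contraTneq Q_gt0 => hxy0.
  have nonneg y' : c y' -> 0 <= \sum_(x | adj y' x) (E * (h x * h y') - Q) ^+ 2.
    by move=> _; apply: sumr_ge0 => *; rewrite sqr_ge0.
  have /(_ y cy) sum0 := psumr_eq0P nonneg V0.
  have nonneg' x' : adj y x' -> 0 <= (E * (h x' * h y) - Q) ^+ 2 by rewrite sqr_ge0.
  have /eqP := psumr_eq0P nonneg' sum0 adj_yx.
  by rewrite hxy0 mulr0 sub0r sqrrN sqrf_eq0 => /eqP->; rewrite ltxx.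
move=> x y cx cy /set0Pn[y' +] /set0Pn[x' +]; rewrite !inE => adj_xy' adj_yx'.
have cy' : c y' by have := proper_c adj_xy'; move: cx; case: (c x); case: (c y').
have hx : h x != 0.
  by apply: contraTneq (edge_neq0 x y' cy' _) => [->|]; rewrite ?mul0r ?eqxx // adj_sym.
have hy : h y != 0.
  by apply: contraTneq (edge_neq0 x' y cy adj_yx') => ->; rewrite mulr0 eqxx.
apply: contraT => nadj.
have nonneg y1 : c y1 -> 0 <= \sum_(x | ~~ c x && ~~ adj y1 x) (h x * h y1) ^+ 2.
  by move=> _; apply: sumr_ge0 => *; rewrite sqr_ge0.
have /(_ y cy) sum0 := psumr_eq0P nonneg Z0.
have nonneg' x1 : ~~ c x1 && ~~ adj y x1 -> 0 <= (h x1 * h y) ^+ 2 by rewrite sqr_ge0.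
have /(_ x) := psumr_eq0P nonneg' sum0; rewrite cx nadj => /(_ isT)/eqP.
by rewrite sqrf_eq0 mulf_eq0 (negPf hx) (negPf hy).
Qed.

End EdgeBound.

Section WeightBound.

Variables (R : realType) (G : sgraph) (r k : R) (h w : G -> R).
Hypothesis sub_h : subinvariant r h.
Hypothesis w_gt0 : forall x, 0 < w x.
Hypothesis super_w : forall x, \sum_(y | adj x y) w y <= k * w x.

Let D1 := \sum_y w y * (\sum_(x | adj y x) h x - r * h y).
Let D2 := \sum_x h x * (k * w x - \sum_(y | adj x y) w y).
Let W := \sum_x h x * w x.

Let W_gt0 : 0 < W.
Proof.
have [_ h_ge0 [x hx] _] := sub_h; rewrite /W (bigD1 x) //= ltr_wpDr ?mulr_gt0 //.
by apply: sumr_ge0 => y _; rewrite mulr_ge0 // ltW.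
Qed.

(** By symmetry of [adj], the neighbour sums of [h] paired with [w] equal those of [w] paired with
    [h]; the nonnegative defects [D1] and [D2] make up the gap between [r] and [k]. *)
Let D12 : r * W + D1 + D2 = k * W.
Proof.
have swap : \sum_y w y * (\sum_(x | adj y x) h x) = \sum_x h x * (\sum_(y | adj x y) w y).
  under eq_bigr => y _ do rewrite mulr_sumr.
  under [RHS]eq_bigr => y _ do rewrite mulr_sumr.
  rewrite (exchange_big_dep xpredT) //=; apply: eq_bigr => x _.
  by apply: eq_big => [y|y _]; [rewrite adj_sym | rewrite mulrC].
have -> : D1 = \sum_y w y * (\sum_(x | adj y x) h x) - r * W.
  by rewrite /W mulr_sumr -sumrB; apply: eq_bigr => y _; ring.
have -> : D2 = k * W - \sum_x h x * (\sum_(y | adj x y) w y).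
  by rewrite /W mulr_sumr -sumrB; apply: eq_bigr => y _; ring.
rewrite swap; ring.
Qed.

Let D1_term y : 0 <= w y * (\sum_(x | adj y x) h x - r * h y).
Proof. by have [_ _ _ hr] := sub_h; rewrite mulr_ge0 ?subr_ge0 // ltW. Qed.

Let D2_term x : 0 <= h x * (k * w x - \sum_(y | adj x y) w y).
Proof. by have [_ h_ge0 _ _] := sub_h; rewrite mulr_ge0 ?subr_ge0. Qed.

Lemma subinvariant_le_weight : r <= k.
Proof.
rewrite -(ler_pM2r W_gt0) -D12 -addrA lerDl addr_ge0 //.
  by apply: sumr_ge0 => y _; exact: D1_term.
by apply: sumr_ge0 => y _; exact: D2_term.
Qed.

(** Both defects vanish term by term; the factor [w] always cancels, the factor [h] only where it is
    positive. *)
Lemma subinvariant_eq_weight : r = k ->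
  (forall y, \sum_(x | adj y x) h x = r * h y) /\
  (forall x, 0 < h x -> \sum_(y | adj x y) w y = k * w x).
Proof.
move=> rk.
have D1_ge0 : 0 <= D1 by apply: sumr_ge0 => y _; exact: D1_term.
have D2_ge0 : 0 <= D2 by apply: sumr_ge0 => y _; exact: D2_term.
have D0 : D1 + D2 = 0 by apply: (addrI (r * W)); rewrite addrA D12 rk addr0.
have D10 : D1 = 0 by lra.
have D20 : D2 = 0 by lra.
split=> [y|x hx].
  have /(_ y isT)/eqP := psumr_eq0P (fun y _ => D1_term y) D10.
  by rewrite mulf_eq0 (gt_eqF (w_gt0 y)) subr_eq0 => /eqP.
have /(_ x isT)/eqP := psumr_eq0P (fun y _ => D2_term y) D20.
by rewrite mulf_eq0 (gt_eqF hx) subr_eq0 => /eqP.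
Qed.

End WeightBound.

(** * Isomorphisms from vertex classes of equal sizes *)

Section Classes.

Local Open Scope nat_scope.

Lemma class_bijection (A B K : finType) (k : A -> K) (l : B -> K) :
    (forall i, #|[set x | k x == i]| = #|[set y | l y == i]|) ->
  exists2 f : A -> B, bijective f & forall x, l (f x) = k x.
Proof.
move=> card_kl.
have card_classes (D : finType) (m : D -> K) : #|D| = \sum_i #|[set x | m x == i]|.
  rewrite -sum1_card (partition_big m xpredT) //=; apply: eq_bigr => i _.
  by rewrite -sum1_card; apply: eq_bigl => x; rewrite inE.
have card_AB : #|A| = #|B| by rewrite (card_classes A k) (card_classes B l); apply: eq_bigr.
case: (pickP (@predT A)) => [x0 _|noA]; last first.
  have f : A -> B by move=> x; have := noA x.
  exists f => [|x]; last by have := noA x.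
  by apply: inj_card_bij; [move=> x; have := noA x | rewrite card_AB].
have [y0 _] : exists y0, y0 \in [set y | l y == k x0].
  by apply/card_gt0P; rewrite -card_kl; apply/card_gt0P; exists x0; rewrite inE.
(* The i-th element of a class goes to the i-th element of the class with the same label; the
   default [y0] is never reached. *)
pose f x := nth y0 (enum [set y | l y == k x]) (index x (enum [set z | k z == k x])).
have idx_lt x : index x (enum [set z | k z == k x]) < size (enum [set y | l y == k x]).
  by rewrite -cardE -card_kl cardE index_mem mem_enum inE.
have lf x : l (f x) = k x.
  by have := mem_nth y0 (idx_lt x); rewrite mem_enum inE => /eqP.
exists f => //; apply: inj_card_bij; last by rewrite card_AB.
move=> x y eq_f; have eq_k : k x = k y by rewrite -!lf eq_f.
move: eq_f (idx_lt x) (idx_lt y); rewrite /f eq_k => /eqP eq_n lt_x lt_y.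
move: eq_n; rewrite nth_uniq ?enum_uniq // => /eqP eq_i.
rewrite -(nth_index x (_ : x \in enum [set z | k z == k y])) ?eq_i ?nth_index //.
- by rewrite mem_enum inE.
- by rewrite mem_enum inE eq_k.
Qed.

Lemma isomorphic_classes (G H : sgraph) (K : finType) (M : rel K) (k : G -> K) (l : H -> K) :
    (forall x y, adj x y = M (k x) (k y)) -> (forall x y, adj x y = M (l x) (l y)) ->
    (forall i, #|[set x | k x == i]| = #|[set y | l y == i]|) ->
  isomorphic G H.
Proof.
move=> adjG adjH /class_bijection[f bij_f lf]; exists f => // x y.
by rewrite adjH !lf -adjG.
Qed.

Lemma card_set_sum (A B : finType) (P : pred (A + B)) :
  #|[set y | P y]| = #|[set x | P (inl x)]| + #|[set x | P (inr x)]|.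
Proof. by rewrite -!sum1dep_card big_sumType. Qed.

Lemma card_set_const (A : finType) (b : bool) : #|[set x : A | b]| = b * #|A|.
Proof.
rewrite cardsE; case: b; first by rewrite mul1n; apply: eq_card.
by rewrite mul0n; apply: eq_card0.
Qed.

Lemma isomorphic_Kbip (G : sgraph) (c : G -> bool) (p q : nat) :
    proper_colouring c -> (forall x y, ~~ c x -> c y -> adj y x) ->
    #|[set x | ~~ c x]| = p -> #|[set x | c x]| = q ->
  isomorphic G (Kbip p q).
Proof.
move=> proper_c complete card_p card_q.
pose l (y : Kbip p q) := if y is inr _ then true else false.
apply: (@isomorphic_classes _ _ bool (fun i j => i != j) c l).
- move=> x y; apply/idP/idP => [/proper_c//|].
  case cx: (c x); case cy: (c y) => // _; first by apply: complete; rewrite ?cx ?cy.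
  by rewrite adj_sym; apply: complete; rewrite ?cx ?cy.
- by case=> ? [] ?.
have card_l i : #|[set y | l y == i]| = if i then q else p.
  by rewrite card_set_sum /= !card_set_const !card_ord; case: i; rewrite /= ?mul0n ?mul1n ?addn0.
case; rewrite card_l; last rewrite -card_p; first rewrite -card_q.
  by apply: eq_card => x; rewrite !inE eqb_id.
by apply: eq_card => x; rewrite !inE eqbF_neg.
Qed.

End Classes.

(** * The quadratic of D(p, x - p; q, 1) *)

Section Quadratic.

Variable R : realType.
Implicit Types p q x nu : R.

(* The squared spectral radius of D(p, x - p; q, 1) is the largest root of
   this quadratic. *)
Definition Dquad p q x nu : R := nu ^+ 2 - (q * x + p) * nu + q * p * (x - p).

(** The discriminant [(qx + p)^2 - 4qp(x - p)] is rewritten as a sum that is visibly nonnegative for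
    [q >= 0]. *)
Definition Droot p q x : R :=
  (q * x + p + Num.sqrt ((q * x - p) ^+ 2 + 4 * p ^+ 2 * q)) / 2.

Lemma Dquad_factor p q x : 0 <= q ->
  exists2 m, m <= Droot p q x &
    forall nu, Dquad p q x nu = (nu - Droot p q x) * (nu - m).
Proof.
move=> q_ge0; pose s := Num.sqrt ((q * x - p) ^+ 2 + 4 * p ^+ 2 * q).
have s_ge0 : 0 <= s by exact: sqrtr_ge0.
have s2 : s ^+ 2 = (q * x - p) ^+ 2 + 4 * p ^+ 2 * q.
  by rewrite sqr_sqrtr // addr_ge0 ?sqr_ge0 // mulr_ge0 // mulr_ge0 ?sqr_ge0.
exists ((q * x + p - s) / 2); first by rewrite /Droot -/s; lra.
move=> nu; rewrite /Droot -/s /Dquad.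
have -> : (nu - (q * x + p + s) / 2) * (nu - (q * x + p - s) / 2) =
  nu ^+ 2 - (q * x + p) * nu + ((q * x + p) ^+ 2 - s ^+ 2) / 4 by field.
by rewrite s2; field.
Qed.

Lemma le_Droot p q x nu : 0 <= q -> Dquad p q x nu <= 0 -> nu <= Droot p q x.
Proof.
move=> q_ge0; have [m le_m ->] := Dquad_factor p x q_ge0.
have [//|lt_nu] := leP nu (Droot p q x).
by rewrite leNgt mulr_gt0 // subr_gt0 // (le_lt_trans le_m).
Qed.

Lemma Dquad_ge0 p q x nu : 0 <= q -> Droot p q x <= nu -> 0 <= Dquad p q x nu.
Proof.
move=> q_ge0 le_nu; have [m le_m ->] := Dquad_factor p x q_ge0.
by rewrite mulr_ge0 // subr_ge0 // (le_trans le_m).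
Qed.

Lemma Dquad_root p q x : 0 <= q -> Dquad p q x (Droot p q x) = 0.
Proof. by move=> q_ge0; have [m _ ->] := Dquad_factor p x q_ge0; rewrite subrr mul0r. Qed.

(** [Dquad] is the characteristic polynomial of the 2 by 2 system in [al] and [be]. Above both
    diagonal entries, multiplying the two inequalities shows that it is nonpositive at [mu];
    otherwise a diagonal entry serves as [nu], since [mu] itself may lie below both roots. *)
Lemma Dquad_le0_of_system p q x2 al be mu : 0 <= p -> 0 <= q -> 0 <= x2 -> 0 <= al -> 0 <= be ->
    0 < al + be -> mu * al <= p * (q * (al + be) + al) -> mu * be <= x2 * (q * (al + be)) ->
  exists2 nu, mu <= nu & Dquad p q (p + x2) nu <= 0.
Proof.
move=> p_ge0 q_ge0 x2_ge0 al_ge0 be_ge0 ab_gt0 le_al le_be.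
have DE nu : Dquad p q (p + x2) nu = (nu - p * q - p) * (nu - x2 * q) - p * x2 * q ^+ 2.
  by rewrite /Dquad; ring.
have pxq : 0 <= p * x2 * q ^+ 2 by rewrite !mulr_ge0 ?sqr_ge0.
have [le1|gt1] := leP mu (p * q + p).
  by exists (p * q + p) => //; rewrite DE; nra.
have [le2|gt2] := leP mu (x2 * q); first by exists (x2 * q) => //; rewrite DE; nra.
exists mu => //; rewrite DE.
have u_gt0 : 0 < mu - p * q - p by lra.
have v_gt0 : 0 < mu - x2 * q by lra.
move: u_gt0 v_gt0; set u := mu - p * q - p; set v := mu - x2 * q => u_gt0 v_gt0.
have le_u : u * al <= p * q * be by rewrite /u; nra.
have le_v : v * be <= x2 * q * al by rewrite /v; nra.
have al_gt0 : 0 < al.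
  rewrite lt_neqAle al_ge0 andbT; apply/eqP => al0.
  have be_gt0 : 0 < be by lra.
  by have := mulr_gt0 v_gt0 be_gt0; rewrite -al0 in le_v; lra.
have be_gt0 : 0 < be.
  rewrite lt_neqAle be_ge0 andbT; apply/eqP => be0.
  by have := mulr_gt0 u_gt0 al_gt0; rewrite -be0 in le_u; lra.
rewrite -(pmulr_lle0 _ (mulr_gt0 al_gt0 be_gt0)).
have : (u * al) * (v * be) <= (p * q * be) * (x2 * q * al).
  by apply: ler_pM => //; rewrite mulr_ge0 // ltW.
by rewrite -subr_le0; congr (_ <= 0); ring.
Qed.

End Quadratic.

(** * The largest root at the parameters of [Dstar] *)

Section Extremal.

Variables (R : realType) (a n : nat).
Hypothesis a_gt0 : (0 < a)%N.
Hypothesis le_an : (a <= n./2)%N.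

Local Notation p := (a - 1)%N.
Local Notation q := n./2.
Local Notation x := (half_pred n).

Definition Dstar_root : R := Droot p%:R q%:R x%:R.

Let q_ge0 : 0 <= q%:R :> R. Proof. exact: ler0n. Qed.

Lemma le_Dstar_root nu : Dquad p%:R q%:R x%:R nu <= 0 -> nu <= Dstar_root.
Proof. exact: le_Droot. Qed.

Lemma Dstar_root_ge_prod : (half_pred n * n./2)%:R <= Dstar_root.
Proof.
apply: le_Dstar_root; rewrite natrM.
have -> : Dquad p%:R q%:R x%:R (x%:R * q%:R) = - (p%:R ^+ 2 * q%:R) :> R.
  by rewrite /Dquad; ring.
by rewrite oppr_le0 mulr_ge0 ?sqr_ge0.
Qed.

(** The quadratic is nonpositive at [xq + p^2 / x], because [p <= x]. *)
Lemma Dstar_root_ge_excess (e : nat) : (0 < half_pred n)%N ->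
    (half_pred n * e <= half_pred n * (half_pred n * n./2) + (a - 1) ^ 2)%N ->
  e%:R <= Dstar_root.
Proof.
move=> x_gt0; have [lt_pq /andP[_ le_qx] _] := half_pred_bounds a_gt0 le_an.
have x_gt0' : 0 < x%:R :> R by rewrite ltr0n.
rewrite -(ler_nat R) natrD natrX !natrM => le_e.
have {}le_e : e%:R <= x%:R * q%:R + p%:R ^+ 2 / x%:R :> R.
  by rewrite -(ler_pM2l x_gt0') mulrDr [_ * (_ / _)]mulrC divfK ?gt_eqF.
apply: le_trans le_e _; apply: le_Dstar_root.
have -> : Dquad p%:R q%:R x%:R (x%:R * q%:R + p%:R ^+ 2 / x%:R) =
   - (p%:R * (x%:R - p%:R) / x%:R * (p%:R ^+ 2 / x%:R)) :> R.
  by rewrite /Dquad; field; rewrite gt_eqF.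
have le_px : p%:R <= x%:R :> R by rewrite ler_nat; lia.
by rewrite oppr_le0 !mulr_ge0 ?invr_ge0 ?subr_ge0 ?ler0n ?sqr_ge0.
Qed.

Lemma Dstar_root_ge_Kbip : ((a - 1) * (n - (a - 1)))%:R <= Dstar_root.
Proof.
have [lt_pq /andP[le_xq le_qx] En] := half_pred_bounds a_gt0 le_an.
apply: le_Dstar_root.
have [k Ek] : exists k, x = (p + k)%N by exists (x - p)%N; lia.
have [i [Ei i_le1]] : exists i, q = (x + i)%N /\ (i <= 1)%N by exists (q - x)%N; lia.
have -> : (n - p = p + 2 * k + i + 1)%N by lia.
rewrite Ei Ek !(natrM, natrD).
have -> : Dquad p%:R (p%:R + k%:R + i%:R) (p%:R + k%:R)
    (p%:R * (p%:R + 2%:R * k%:R + i%:R + 1%:R)) = - (p%:R * (k%:R *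
    ((k%:R + i%:R) * (p%:R + 2%:R * k%:R + i%:R + 1%:R) - (p%:R + k%:R + i%:R)))) :> R.
  by rewrite /Dquad; ring.
rewrite oppr_le0 mulr_ge0 ?ler0n //; have [->|k_gt0] := posnP k; first by rewrite mul0r.
rewrite mulr_ge0 ?ler0n // subr_ge0 -!natrM -!natrD -natrM ler_nat.
by clear -k_gt0; nia.
Qed.

(** Unbalancing the parts by [j] raises the quadratic at [nu] by [j((j - i)(nu - p) + p^2)] or
    [j((j + i)(nu - p) - p^2)], where [i = q - x] is 0 or 1. The first vanishes for [p = 0],
    [j = i], the case [a = 1], [y = n./2] excluded by hypothesis. *)
Lemma Dquad_shift (y z : nat) (nu : R) : (y + z = half_pred n + n./2)%N ->
    y != half_pred n -> (1 < a)%N || (y != n./2) -> (0 < half_pred n)%N ->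
    (half_pred n * n./2)%:R <= nu ->
  Dquad p%:R q%:R x%:R nu < Dquad p%:R z%:R y%:R nu.
Proof.
have [lt_pq /andP[le_xq le_qx] _] := half_pred_bounds a_gt0 le_an.
move=> Eyz neq_yx ap x_gt0.
have [i [Ei i_le1]] : exists i, q = (x + i)%N /\ (i <= 1)%N by exists (q - x)%N; lia.
have x_ge1 : 1 <= x%:R :> R by rewrite ler1n.
have p_ge0 : 0 <= p%:R :> R by exact: ler0n.
have lt_pq' : p%:R + 1 <= q%:R :> R by rewrite natr1 ler_nat.
rewrite natrM => le_nu; rewrite -subr_gt0.
have qE : q%:R = x%:R + i%:R :> R by rewrite Ei natrD.
have p_lt_nu : p%:R < nu by nra.
have [lt_xy|] := ltnP x y; last rewrite leq_eqVlt (negPf neq_yx) /= => lt_yx.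
  have [j [Ej j_gt0]] : exists j, y = (x + j)%N /\ (0 < j)%N by exists (y - x)%N; lia.
  have Ez : q = (z + j)%N by lia.
  have zE : z%:R = x%:R + i%:R - j%:R :> R by rewrite -qE Ez natrD addrK.
  have -> : Dquad p%:R z%:R y%:R nu - Dquad p%:R q%:R x%:R nu =
      j%:R * ((j%:R - i%:R) * (nu - p%:R) + p%:R ^+ 2).
    by rewrite /Dquad zE qE Ej natrD; ring.
  apply: mulr_gt0; first by rewrite ltr0n.
  have [lt_ij|le_ji] := ltnP i j.
    by rewrite ltr_wpDr ?sqr_ge0 // mulr_gt0 ?subr_gt0 ?ltr_nat.
  have [Eij p_gt0] : j = i /\ (0 < p)%N by lia.
  by rewrite Eij subrr mul0r add0r exprn_gt0 // ltr0n.
have [j [Ej j_gt0]] : exists j, x = (y + j)%N /\ (0 < j)%N by exists (x - y)%N; lia.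
have Ez : z = (q + j)%N by lia.
have yE : y%:R = x%:R - j%:R :> R by rewrite Ej natrD addrK.
have -> : Dquad p%:R z%:R y%:R nu - Dquad p%:R q%:R x%:R nu =
    j%:R * ((j%:R + i%:R) * (nu - p%:R) - p%:R ^+ 2).
  by rewrite /Dquad Ez natrD qE yE; ring.
apply: mulr_gt0; rewrite ?ltr0n // subr_gt0.
have j_ge1 : 1 <= j%:R :> R by rewrite ler1n.
apply: (@lt_le_trans _ _ ((1 + i%:R) * (nu - p%:R))); last first.
  by rewrite ler_wpM2r ?subr_ge0 ?(ltW p_lt_nu) // lerD2r.
move: qE lt_pq' le_nu; case: (i) i_le1 => [|[|//]] _ -> lt_pq' le_nu;
  rewrite ?addr0 in lt_pq' le_nu *; nra.
Qed.

Lemma Dstar_root_eigen : (0 < half_pred n)%N -> exists tau : R,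
  [/\ 0 <= tau, Dstar_root = q%:R * x%:R + p%:R * tau,
      Dstar_root * tau = p%:R * (q%:R + tau) & (1 < a)%N -> 0 < tau].
Proof.
move=> x_gt0; have x_gt0' : 0 < x%:R :> R by rewrite ltr0n.
have [p0|p_gt0] := posnP p.
  exists 0; split=> //; last by lia.
    rewrite mulr0 addr0 /Dstar_root /Droot p0 subr0 expr0n /= mulr0 mul0r !addr0.
    by rewrite sqrtr_sqr ger0_norm ?mulr_ge0 ?ler0n //; lra.
  by rewrite p0 mulr0 mul0r.
have p_gt0' : 0 < p%:R :> R by rewrite ltr0n.
have := Dquad_root p%:R x%:R q_ge0; rewrite -/Dstar_root => root0.
have prod_le : q%:R * x%:R <= Dstar_root.
  by rewrite mulrC -natrM; exact: Dstar_root_ge_prod.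
have q_gt0 : 0 < q%:R :> R by rewrite ltr0n; move: a_gt0 le_an; lia.
have tau_ge0 : 0 <= (Dstar_root - q%:R * x%:R) / p%:R by rewrite divr_ge0 ?subr_ge0 ?ler0n.
have tauE : p%:R * ((Dstar_root - q%:R * x%:R) / p%:R) = Dstar_root - q%:R * x%:R.
  by rewrite mulrC divfK ?gt_eqF.
move: (_ / p%:R) tau_ge0 tauE => tau tau_ge0 tauE.
have rootE : Dstar_root * tau = p%:R * (q%:R + tau).
  apply: (mulfI (lt0r_neq0 p_gt0')); rewrite mulrCA tauE.
  have -> : p%:R * (p%:R * (q%:R + tau)) = p%:R ^+ 2 * q%:R + p%:R * (p%:R * tau) by ring.
  by rewrite tauE; move: root0; rewrite /Dquad; lra.
exists tau; split=> //; first by rewrite tauE; ring.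
move=> _; rewrite lt_neqAle tau_ge0 andbT; apply/eqP => tau0.
move: rootE; rewrite -tau0 mulr0 addr0 => /eqP; rewrite eq_sym mulf_eq0.
by rewrite !gt_eqF.
Qed.

(** For [a = 1] the vertex of [Y_2] is isolated and that eigenvector vanishes there; [tau = 1] gives
    a positive weight at the price of an inequality. *)
Lemma Dstar_root_weight : (0 < half_pred n)%N -> exists tau : R,
  [/\ 0 < tau, Dstar_root = q%:R * x%:R + p%:R * tau
    & p%:R * (q%:R + tau) <= Dstar_root * tau].
Proof.
move=> x_gt0; have [tau [tau_ge0 rootE tauE tau_gt0]] := Dstar_root_eigen x_gt0.
have [a1|/tau_gt0 {}tau_gt0] := leqP a 1; last by exists tau; split; rewrite ?tauE.
have p0 : p = 0%N by lia.
exists 1; split=> //; first by rewrite rootE p0 !mul0r.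
rewrite p0 mul0r mulr1; apply: le_trans Dstar_root_ge_prod; exact: ler0n.
Qed.

End Extremal.

(** * Vertices of low degree *)

Lemma isomorphic_Dbip (G : sgraph) (c : G -> bool) (v : G) (P : {set G}) (p1 p2 q1 : nat) :
    proper_colouring c -> c v -> P \subset [set x | ~~ c x] ->
    (forall x y, ~~ c x -> c y -> adj y x = (y != v) || (x \in P)) ->
    #|P| = p1 -> #|[set x | ~~ c x] :\: P| = p2 -> #|[set x | c x] :\ v| = q1 ->
  isomorphic G (Dbip p1 p2 q1 1).
Proof.
move=> proper_c cv sPX adjE cardP cardX cardY.
pose k x := (c x, if c x then x == v else x \in P).
pose l (y : Dbip p1 p2 q1 1) := match y with
  | inl (inl _) => (false, true) | inl (inr _) => (false, false)
  | inr (inl _) => (true, false) | inr (inr _) => (true, true) end.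
(* The flag marks [X_1] and [Y_2]: a flagged vertex of [Y] sees only flagged vertices of [X]. *)
pose M (i j : bool * bool) :=
  (i.1 != j.1) && (if i.1 then i.2 ==> j.2 else j.2 ==> i.2).
apply: (@isomorphic_classes _ _ _ M k l).
- move=> x y; rewrite /M /k /=.
  have nadj : c x = c y -> adj x y = false.
    by move=> cxy; apply/negP => /proper_c; rewrite cxy eqxx.
  case cx: (c x) nadj; case cy: (c y) => nadj /=; try by rewrite nadj.
    by rewrite adjE ?cx ?cy // implybE.
  by rewrite adj_sym adjE ?cx ?cy // implybE.
- by move=> [[?|?]|[?|?]] [[?|?]|[?|?]].
have card_l i : #|[set y | l y == i]| =
    if i.1 then (if i.2 then 1 else q1)%N else (if i.2 then p1 else p2).
  rewrite card_set_sum !(@card_set_sum _ _ (fun y => l (_ y) == i)) /=.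
  by rewrite !card_set_const !card_ord; case: i => [[] []] /=; rewrite ?mul0n ?mul1n ?addn0.
have inP x : x \in P -> ~~ c x by move/(subsetP sPX); rewrite inE.
case=> [[] []]; rewrite card_l /= -?cardP -?cardX -?cardY.
- rewrite -(cards1 v); apply: eq_card => x; rewrite !inE /k xpair_eqE.
  by case cx: (c x) => /=; [rewrite eqb_id | apply/esym/eqP => xv; rewrite xv cv in cx].
- apply: eq_card => x; rewrite !inE /k xpair_eqE.
  by case: (c x) => /=; rewrite ?eqbF_neg ?andbT ?andbF.
- apply: eq_card => x; rewrite !inE /k xpair_eqE.
  case cx: (c x) => /=; last by rewrite eqb_id.
  by apply/esym/negP => /inP; rewrite cx.
apply: eq_card => x; rewrite !inE /k xpair_eqE.
by case: (c x) => /=; rewrite ?eqbF_neg ?andbT ?andbF.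
Qed.

Lemma exists_subset_card (T : finType) (A B : {set T}) (m : nat) :
    A \subset B -> (#|A| <= m <= #|B|)%N ->
  exists P : {set T}, [/\ A \subset P, P \subset B & #|P| = m].
Proof.
move=> sAB /andP[]; elim: m => [|m IHm].
  by rewrite leqn0 => /eqP A0 _; exists A.
rewrite leq_eqVlt => /orP[/eqP A_m _|ltAm ltmB]; first by exists A.
have [P [sAP sPB cardP]] := IHm ltAm (ltnW ltmB).
have /card_gt0P[x] : (0 < #|B :\: P|)%N.
  by rewrite cardsD (setIidPr sPB) subn_gt0 cardP.
rewrite inE => /andP[xP xB]; exists (x |: P); split.
- exact: subset_trans sAP (subsetUr _ _).
- by rewrite subUset sub1set xB.
- by rewrite cardsU1 xP cardP.
Qed.

Lemma edges_le_prod (G : sgraph) (c : G -> bool) : proper_colouring c ->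
  (edges c <= #|[set x | ~~ c x]| * #|[set y | c y]|)%N.
Proof.
move=> proper_c; rewrite mulnC /edges -sum_nat_const big_mkcond [leqRHS]big_mkcond /=.
apply: leq_sum => y _; rewrite inE; case: ifP => // cy; apply: subset_leq_card.
by apply/subsetP => x; rewrite !inE => /proper_c; rewrite cy; case: (c x).
Qed.

Lemma card_colours (G : sgraph) (c : G -> bool) :
  (#|[set x | ~~ c x]| + #|[set y | c y]|)%N = #|G|.
Proof.
by rewrite addnC -(cardC [set y | c y]); congr (_ + _)%N; apply: eq_card => x; rewrite !inE.
Qed.

Lemma sub_sumr (R : realType) (T : finType) (w : T -> R) (A B : pred T) :
    (forall x, 0 <= w x) -> subpred A B -> \sum_(x | A x) w x <= \sum_(x | B x) w x.
Proof.
move=> w_ge0 sAB; rewrite [leRHS](bigID A) /=.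
rewrite (eq_bigl A) => [|x]; first by rewrite lerDl sumr_ge0.
by case Ax: (A x); rewrite ?andbF // sAB.
Qed.

Lemma sub_sumr_eq (R : realType) (T : finType) (w : T -> R) (A B : pred T) :
    (forall x, 0 < w x) -> subpred A B -> \sum_(x | A x) w x = \sum_(x | B x) w x ->
  subpred B A.
Proof.
move=> w_gt0 sAB; rewrite [RHS](bigID A) /=.
rewrite [X in _ = X + _](eq_bigl A) => [|x]; last first.
  by case Ax: (A x); rewrite ?andbF // sAB.
rewrite -[LHS]addr0 => /addrI/esym sum0 x Bx.
have nonneg y : B y && ~~ A y -> 0 <= w y by rewrite ltW.
apply: contraT => nAx; have /(_ x) := psumr_eq0P nonneg sum0; rewrite Bx nAx => /(_ isT) wx0.
by have := w_gt0 x; rewrite wx0 ltxx.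
Qed.

Section LowDegree.

Variables (R : realType) (G : sgraph) (c : G -> bool) (v : G) (P : {set G}).
Hypothesis proper_c : proper_colouring c.
Hypothesis cv : c v.
Hypothesis sNP : nbrs v \subset P.
Hypothesis sPX : P \subset [set x | ~~ c x].

Let inP x : x \in P -> ~~ c x. Proof. by move/(subsetP sPX); rewrite inE. Qed.

Let nbr_v x : adj v x -> x \in P.
Proof. by move=> adj_vx; apply: (subsetP sNP); rewrite inE. Qed.

Let nbr_X x y : ~~ c x -> adj x y -> c y.
Proof. by move=> cx /proper_c; move: cx; case: (c x); case: (c y). Qed.

Let nbr_Y x y : c x -> adj x y -> ~~ c y.
Proof. by move=> cx /proper_c; rewrite cx; case: (c y). Qed.

Let nbr_XP x y : ~~ c x -> x \notin P -> adj x y -> c y && (y != v).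
Proof.
move=> cx xP adj_xy; rewrite (nbr_X cx adj_xy) /=; apply: contraNneq xP => yv.
by apply: nbr_v; rewrite adj_sym -yv.
Qed.

(** [G] is a subgraph of a graph [D] with [X_1 = P] and [Y_2 = {v}]. Summing subinvariance over the
    four classes and eliminating [ga] and [h v] leaves a 2 by 2 system for [r^2]. *)
Lemma Dquad_of_subinvariant (r : R) (h : G -> R) : subinvariant r h -> 0 < r ->
  exists2 nu, r ^+ 2 <= nu &
    Dquad #|P|%:R #|[set x | c x] :\ v|%:R #|[set x | ~~ c x]|%:R nu <= 0.
Proof.
move=> [_ h_ge0 [z hz] hr] r_gt0.
pose al := \sum_(x in P) h x; pose be := \sum_(x in [set x | ~~ c x] :\: P) h x.
pose ga := \sum_(x in [set x | c x] :\ v) h x.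
have sumX : \sum_(x | ~~ c x) h x = al + be.
  rewrite (bigID (mem P)) /=; congr (_ + _); apply: eq_bigl => x.
    by case: (boolP (x \in P)) => [/inP->|]; rewrite ?andbF.
  by rewrite !inE andbC.
have sumY : \sum_(x | c x) h x = ga + h v.
  rewrite (bigD1 v) //= addrC; congr (_ + _); apply: eq_bigl => x.
  by rewrite !inE andbC.
have [al_ge0 be_ge0] : 0 <= al /\ 0 <= be by split; apply: sumr_ge0.
have bound (A : {set G}) (m : R) : (forall x, x \in A -> r * h x <= m) ->
    r * \sum_(x in A) h x <= #|A|%:R * m.
  by move=> le_m; rewrite mulr_sumr mulr_natl -sumr_const; apply: ler_sum.
have le_al : r * al <= #|P|%:R * (ga + h v).
  apply: bound => x xP; apply: le_trans (hr x) _; rewrite -sumY.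
  by apply: sub_sumr => // y; apply: nbr_X (inP xP).
have le_be : r * be <= #|[set x | ~~ c x] :\: P|%:R * ga.
  apply: bound => x; rewrite !inE => /andP[xP cx]; apply: le_trans (hr x) _.
  by apply: sub_sumr => // y adj_xy; rewrite !inE andbC; exact: nbr_XP adj_xy.
have le_ga : r * ga <= #|[set x | c x] :\ v|%:R * (al + be).
  apply: bound => x; rewrite !inE => /andP[_ cx]; apply: le_trans (hr x) _.
  by rewrite -sumX; apply: sub_sumr => // y; exact: nbr_Y.
have le_de : r * h v <= al.
  by apply: le_trans (hr v) _; apply: sub_sumr => // y; exact: nbr_v.
have ab_gt0 : 0 < al + be.
  rewrite -sumX; have [cz|ncz] := boolP (c z).
    apply: lt_le_trans (mulr_gt0 r_gt0 hz) _; apply: le_trans (hr z) _.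
    by apply: sub_sumr => // y; exact: nbr_Y.
  apply: lt_le_trans hz _; rewrite (bigD1 z) //= lerDl; exact: sumr_ge0.
have -> : #|[set x | ~~ c x]|%:R = #|P|%:R + #|[set x | ~~ c x] :\: P|%:R :> R.
  by rewrite -natrD cardsD (setIidPr sPX) subnKC // subset_leq_card.
apply: Dquad_le0_of_system ab_gt0 _ _; rewrite ?ler0n //.
  rewrite expr2 -mulrA; apply: (@le_trans _ _ (r * (#|P|%:R * (ga + h v)))).
    by rewrite ler_wpM2l // ltW.
  by rewrite mulrCA ler_wpM2l ?ler0n // mulrDr lerD.
rewrite expr2 -mulrA; apply: (@le_trans _ _ (r * (#|[set x | ~~ c x] :\: P|%:R * ga))).
  by rewrite ler_wpM2l // ltW.
by rewrite mulrCA ler_wpM2l ?ler0n.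
Qed.

Section ExtremalSize.

Variables (a n : nat) (r : R) (h : G -> R).
Hypothesis a_gt0 : (0 < a)%N.
Hypothesis le_an : (a <= n./2)%N.
Hypothesis x_gt0 : (0 < half_pred n)%N.
Hypothesis cardP : #|P| = (a - 1)%N.
Hypothesis cardX : #|[set x | ~~ c x]| = half_pred n.
Hypothesis cardY : #|[set x | c x] :\ v| = n./2.
Hypothesis sub_h : subinvariant r h.

Local Notation L := (Dstar_root R a n).

Let cardXP : #|[set x | ~~ c x] :\: P|%:R = (half_pred n)%:R - (a - 1)%:R :> R.
Proof.
rewrite cardsD (setIidPr sPX) cardX cardP natrB //.
by rewrite -cardX -cardP subset_leq_card.
Qed.

(** [D] is the adjacency of [Dstar] laid over [G] and [w] its positive weight, so the weight
    comparison applies. In the equality case, positivity of [h] spreads from one vertex of [X] to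
    [Y] without [v] and back to all of [X], which forces every edge of [D] into [G]. *)
Lemma extremal_size_bound : r ^+ 2 <= L /\ (r ^+ 2 = L -> isomorphic G (Dstar a n)).
Proof.
have [tau [tau_gt0 LE le_tau]] := Dstar_root_weight R a_gt0 le_an x_gt0.
have q_gt0 : (0 < n./2)%N by lia.
have q_gt0' : 0 < (n./2)%:R :> R by rewrite ltr0n.
have L_gt0 : 0 < L.
  by apply: lt_le_trans (Dstar_root_ge_prod R a n); rewrite ltr0n muln_gt0 x_gt0.
pose k := Num.sqrt L; have k2 : k * k = L by rewrite -expr2 sqr_sqrtr ?ltW.
have k_gt0 : 0 < k by rewrite sqrtr_gt0.
pose w y := if c y then (if y == v then k * tau else k)
            else (if y \in P then (n./2)%:R + tau else (n./2)%:R).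
have w_gt0 x : 0 < w x.
  by rewrite /w; case: ifP => _; case: ifP => _; rewrite ?mulr_gt0 ?addr_gt0.
have w_ge0 x : 0 <= w x by exact: ltW.
pose D x y := if c x then (if x == v then y \in P else ~~ c y)
              else c y && ((x \in P) || (y != v)).
have sub_D x : subpred (adj x) (D x).
  move=> y adj_xy; rewrite /D; have [cx|cx] := boolP (c x).
    by have [xv|_] := eqVneq x v; [apply: nbr_v; rewrite -xv | exact: nbr_Y adj_xy].
  have [xP|xP] := boolP (x \in P); first by rewrite (nbr_X cx adj_xy).
  exact: nbr_XP adj_xy.
have sumP : \sum_(y in P) w y = (a - 1)%:R * ((n./2)%:R + tau).
  rewrite (eq_bigr (fun _ => (n./2)%:R + tau)) => [|y yP]; last first.
    by rewrite /w (negPf (inP yP)) yP.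
  by rewrite sumr_const cardP mulr_natl.
have sumXP : \sum_(y in [set x | ~~ c x] :\: P) w y =
    ((half_pred n)%:R - (a - 1)%:R) * (n./2)%:R.
  rewrite (eq_bigr (fun _ => (n./2)%:R)) => [|y]; last first.
    by rewrite !inE /w => /andP[/negPf-> /negPf->].
  by rewrite sumr_const -[LHS]mulr_natl cardXP.
have sumYv : \sum_(y in [set x | c x] :\ v) w y = (n./2)%:R * k.
  rewrite (eq_bigr (fun _ => k)) => [|y]; last first.
    by rewrite !inE /w => /andP[/negPf-> ->].
  by rewrite sumr_const cardY mulr_natl.
have sumX : \sum_(y | ~~ c y) w y = k * k.
  rewrite k2 LE (bigID (mem P)) /= (eq_bigl (fun y => y \in P)) => [|y]; last first.
    by case: (boolP (y \in P)) => [/inP->|]; rewrite ?andbF.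
  rewrite sumP (eq_bigl (fun y => y \in [set x | ~~ c x] :\: P)) => [|y]; last first.
    by rewrite !inE andbC.
  by rewrite sumXP; ring.
(* The weight equation can be strict only at [v]; edges at [v] are later recovered from their ends
   in [X]. *)
have sum_D_eq x : x != v -> \sum_(y | D x y) w y = k * w x.
  move=> xv; rewrite /D [w x]/w (negPf xv); case: (c x); first exact: sumX.
  case: (x \in P) => /=; last first.
    by rewrite [RHS]mulrC -sumYv; apply: eq_bigl => y; rewrite !inE andbC.
  rewrite (eq_bigl c) => [|y]; last by rewrite andbT.
  rewrite (bigD1 v) //= (eq_bigl (fun y => y \in [set x | c x] :\ v)) => [|y]; last first.
    by rewrite !inE andbC.
  by rewrite sumYv [w v]/w cv eqxx; ring.
have sum_D x : \sum_(y | D x y) w y <= k * w x.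
  have [->|xv] := eqVneq x v; last by rewrite sum_D_eq.
  by rewrite /D [w v]/w cv eqxx sumP mulrA k2.
have super_w x : \sum_(y | adj x y) w y <= k * w x.
  by apply: le_trans (sum_D x); apply: sub_sumr (sub_D x).
have [r_ge0 h_ge0 [z hz] _] := sub_h.
split.
  rewrite -k2 -expr2 lerXn2r ?nnegrE ?(ltW k_gt0) //.
  exact: (subinvariant_le_weight sub_h w_gt0).
move=> r2; have rk : r = k by rewrite /k -r2 sqrtr_sqr ger0_norm.
have [h_eq w_eq] := subinvariant_eq_weight sub_h w_gt0 super_w rk.
have full x : x != v -> 0 < h x -> subpred (D x) (adj x).
  by move=> xv hx; apply: (sub_sumr_eq w_gt0 (sub_D x)); rewrite w_eq // sum_D_eq.
have pos x y : adj x y -> 0 < h y -> 0 < h x.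
  move=> adj_xy hy; have : 0 < r * h x.
    by rewrite -h_eq (bigD1 y) //= ltr_wpDr // sumr_ge0.
  by rewrite pmulr_rgt0 // rk.
have [u cu hu] : exists2 u, ~~ c u & 0 < h u.
  have [cz|] := boolP (c z); last by exists z.
  case: (pickP [pred x | adj z x && (0 < h x)]) => [x /andP[adj_zx hx]|none].
    by exists x => //; exact: nbr_Y adj_zx.
  have : r * h z = 0.
    rewrite -h_eq big1 // => x adj_zx; apply/le_anti; rewrite h_ge0 andbT leNgt.
    by have := none x; rewrite /= adj_zx /= => ->.
  by move/eqP; rewrite mulf_eq0 rk !gt_eqF.
have neq_v x : ~~ c x -> x != v by apply: contraNneq => ->.
have posY y : c y -> y != v -> 0 < h y.
  move=> cy yv; apply: (pos y u) => //; rewrite adj_sym; apply: full => //.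
    exact: neq_v.
  by rewrite /D (negPf cu) cy yv orbT.
have /card_gt0P[y0] : (0 < #|[set x | c x] :\ v|)%N by rewrite cardY.
rewrite !inE => /andP[y0v cy0].
have posX x : ~~ c x -> 0 < h x.
  move=> cx; apply: (pos x y0); last exact: posY.
  rewrite adj_sym; apply: full => //; first exact: posY.
  by rewrite /D cy0 (negPf y0v).
apply: (isomorphic_Dbip proper_c cv sPX) => //.
  move=> x y cx cy; apply/idP/idP => [adj_yx|yP].
    by have [yv|//] := eqVneq y v; apply: nbr_v; rewrite -yv.
  rewrite adj_sym; apply: full (posX x cx) _ _; first exact: neq_v.
  by rewrite /D (negPf cx) cy orbC.
by rewrite cardsD (setIidPr sPX) cardX cardP /half_pred -subnDA subnKC.
Qed.

End ExtremalSize.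

End LowDegree.

Lemma card_colour_remove (G : sgraph) (c : G -> bool) (v : G) : c v ->
  #|[set x | c x]| = #|[set x | c x] :\ v|.+1.
Proof. by move=> cv; rewrite (cardsD1 v) inE cv. Qed.

Lemma no_edges_of_isolated (G : sgraph) (v : G) :
  #|G| = 2 -> nbrs v = set0 -> forall x y : G, ~~ adj x y.
Proof.
move=> card2 Nv0 x y; apply/negP => adj_xy.
have nadj z : adj v z = false by have /setP/(_ z) := Nv0; rewrite !inE.
have uniq3 : uniq [:: x; y; v].
  rewrite /= !inE !negb_or andbT -andbA; apply/and3P; split.
  - by apply: contraTneq adj_xy => ->; rewrite adj_irr.
  - by apply: contraTneq adj_xy => ->; rewrite nadj.
  - by apply: contraTneq adj_xy => ->; rewrite adj_sym nadj.
by have := max_card (mem [:: x; y; v]); rewrite (card_uniqP uniq3) card2.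
Qed.

Section LowDegreeBound.

Variables (R : realType) (a n : nat) (G : sgraph) (r : R) (h : G -> R).
Hypothesis a_gt0 : (0 < a)%N.
Hypothesis le_an : (a <= n./2)%N.
Hypothesis cardG : #|G| = n.
Hypothesis sub_h : subinvariant r h.

Local Notation L := (Dstar_root R a n).

Lemma low_degree_order2 (v : G) : half_pred n = 0%N -> (#|nbrs v| < a)%N ->
  r ^+ 2 <= L /\ (r ^+ 2 = L -> isomorphic G (Dstar a n)).
Proof.
move=> x0 deg_v; have n2 : n = 2 by move: x0; rewrite /half_pred; lia.
have a1 : a = 1%N by move: le_an; rewrite n2; lia.
have Nv0 : nbrs v = set0 by apply/eqP; rewrite -cards_eq0 -leqn0 -ltnS -a1.
have nadj := no_edges_of_isolated (etrans cardG n2) Nv0.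
split.
  have [r_ge0 _ [z hz] /(_ z)] := sub_h.
  rewrite big_pred0 => [|y]; last exact: negbTE (nadj z y).
  rewrite pmulr_lle0 // => r_le0; have -> : r = 0 by apply/le_anti; rewrite r_le0.
  rewrite expr0n; apply: le_trans (Dstar_root_ge_prod R a n); exact: ler0n.
move=> _; rewrite /Dstar n2 a1.
(* Here [Dstar] is [D(0, 0; 1, 1)], so both vertices receive colour [true]. *)
apply: (@isomorphic_Dbip _ xpredT v set0) => //.
- by move=> x y adj_xy; have := nadj x y; rewrite adj_xy.
- by rewrite cards0.
- by apply/eqP; rewrite cards_eq0; apply/eqP/setP => x; rewrite !inE.
have := card_colour_remove (c := xpredT) (v := v) isT.
have -> : [set x | xpredT x] = [set: G] by apply/setP => x; rewrite !inE.
by rewrite cardsT cardG n2 => -[].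
Qed.

(** If the part opposite [v] has fewer than [a - 1] vertices, the edge count decides. If it has the
    size occurring in [Dstar], the weight comparison applies; other sizes are strictly worse by
    [Dquad_shift], up to recolouring an isolated vertex. *)
Lemma low_degree_bound (c : G -> bool) (v : G) :
    proper_colouring c -> (#|nbrs v| < a)%N ->
  r ^+ 2 <= L /\ (r ^+ 2 = L -> isomorphic G (Dstar a n)).
Proof.
wlog cv : c / c v => [IH proper_c|proper_c deg_v].
  apply: (IH (fun w => c w == c v)); first exact: eqxx.
  by move=> x y /proper_c; case: (c x); case: (c y); case: (c v).
have [x0|x_gt0] := posnP (half_pred n); first exact: low_degree_order2 x0 deg_v.
have [lt_pq /andP[le_xq le_qx] En] := half_pred_bounds a_gt0 le_an.
have cardXY := card_colours c; have cardY := card_colour_remove cv.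
rewrite cardG cardY in cardXY.
have strict : r ^+ 2 < L -> r ^+ 2 <= L /\ (r ^+ 2 = L -> isomorphic G (Dstar a n)).
  by move=> lt_rL; split=> [|rL]; [exact: ltW | rewrite rL ltxx in lt_rL].
have sNX : nbrs v \subset [set x | ~~ c x].
  by apply/subsetP => x; rewrite !inE => /proper_c; rewrite cv; case: (c x).
have [lt_xa|le_ax] := ltnP #|[set x | ~~ c x]| (a - 1).
  apply: strict; apply: le_lt_trans (subinvariant_le_edges proper_c sub_h) _.
  apply: lt_le_trans (Dstar_root_ge_Kbip R a_gt0 le_an); rewrite ltr_nat.
  apply: leq_ltn_trans (edges_le_prod proper_c) _; rewrite cardY.
  move: #|[set x | ~~ c x]| #|[set x | c x] :\ v| lt_xa cardXY => x y lt_xa cardXY.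
  have [i Ei] : exists i, (a - 1 = x + i.+1)%N by exists (a - 1 - x).-1; lia.
  have [j Ej] : exists j, (y = x + i.+1 + i.+1 + j)%N.
    by exists (y - (x + i.+1 + i.+1))%N; lia.
  have -> : (n - (a - 1) = x + i.+1 + j + 1)%N by lia.
  by rewrite Ei Ej; clear; nia.
have [|P [sNP sPX cardP]] := exists_subset_card (m := (a - 1)%N) sNX.
  by rewrite le_ax andbT; lia.
have [cardX|neq_x] := eqVneq #|[set x | ~~ c x]| (half_pred n).
  apply: (extremal_size_bound proper_c cv sNP sPX _ _ _ cardP cardX _ sub_h) => //.
  by apply: (@addnI (half_pred n)); apply: succn_inj; rewrite En -[RHS]cardXY cardX addnS.
have [/andP[/eqP a1 /eqP xq]|nsym] := boolP ((a == 1%N) && (#|[set x | ~~ c x]| == n./2)).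
  (* An isolated vertex may be moved to the other colour class. *)
  have P0 : P = set0 by apply/eqP; rewrite -cards_eq0 cardP a1.
  pose c' w := (w == v) || ~~ c w.
  have nadj z : adj v z = false.
    by apply/negP => adj_vz; move/subsetP/(_ z): sNP; rewrite P0 !inE => /(_ adj_vz).
  have proper_c' : proper_colouring c'.
    move=> x y adj_xy; rewrite /c'.
    have /negPf-> : x != v by apply: contraTneq adj_xy => ->; rewrite nadj.
    have /negPf-> : y != v by apply: contraTneq adj_xy => ->; rewrite adj_sym nadj.
    by have := proper_c _ _ adj_xy; case: (c x); case: (c y).
  have X'E : [set x | ~~ c' x] = [set x | c x] :\ v.
    by apply/setP => x; rewrite !inE /c' negb_or negbK.
  have Y'E : [set x | c' x] :\ v = [set x | ~~ c x].
    apply/setP => x; rewrite !inE /c'; case: (eqVneq x v) => [->|] //=.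
    by rewrite cv.
  have cv' : c' v by rewrite /c' eqxx.
  have sPX' : P \subset [set x | ~~ c' x] by rewrite P0 sub0set.
  apply: (extremal_size_bound proper_c' cv' sNP sPX' _ _ _ cardP _ _ sub_h) => //.
  - apply: (@addnI n./2); apply: succn_inj.
    by rewrite X'E [in RHS]addnC En -[RHS]cardXY xq addnS.
  - by rewrite Y'E.
apply: strict; have [r_ge0 _ _ _] := sub_h.
have L_ge := Dstar_root_ge_prod R a n.
have [r0|r_neq0] := eqVneq r 0.
  rewrite r0 expr0n; apply: lt_le_trans L_ge; rewrite ltr0n muln_gt0 x_gt0; lia.
have r_gt0 : 0 < r by rewrite lt_neqAle eq_sym r_neq0.
have [nu le_nu nu_le0] := Dquad_of_subinvariant proper_c cv sNP sPX sub_h r_gt0.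
(* Were [r^2 >= L], then also [nu >= L], where [Dquad_shift] makes the quadratic positive. *)
rewrite ltNge; apply/negP => le_L; have L_nu := le_trans le_L le_nu.
move: nu_le0; rewrite leNgt => /negP; apply; rewrite cardP.
apply: le_lt_trans (Dquad_ge0 (ler0n R _) L_nu) _.
apply: Dquad_shift => //; last exact: le_trans L_nu.
  by apply: succn_inj; rewrite En -[RHS]cardXY addnS.
move: nsym; rewrite negb_and => /orP[a_neq1|->]; last by rewrite orbT.
by rewrite ltn_neqAle eq_sym a_neq1 a_gt0.
Qed.

End LowDegreeBound.

(** * Spectral radii of the extremal graphs *)

Lemma sumr_ord_const (R : realType) (m : nat) (x : R) : \sum_(i < m) x = m%:R * x.
Proof. by rewrite sumr_const card_ord mulr_natl. Qed.

Lemma spectral_radius_Kbip (R : realType) (p q : nat) : (0 < p + q)%N ->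
  spectral_radius R (Kbip p q) = Num.sqrt (p * q)%:R.
Proof.
move=> pq_gt0.
have K_gt0 : (0 < #|Kbip p q|)%N by rewrite card_sum !card_ord.
have rho_ge0 := spectral_radius_ge0 R K_gt0.
apply/le_anti/andP; split.
  have [h sub_h] := spectral_radius_subinvariant R K_gt0.
  pose c (y : Kbip p q) := if y is inr _ then true else false.
  have proper_c : proper_colouring c by case=> ? [] ?.
  rewrite -[leLHS]ger0_norm // -sqrtr_sqr ler_wsqrtr //.
  apply: le_trans (subinvariant_le_edges proper_c sub_h) _; rewrite ler_nat.
  apply: leq_trans (edges_le_prod proper_c) _.
  by rewrite !card_set_sum /= !card_set_const !card_ord !mul1n !mul0n addn0.
have [pq0|] := posnP (p * q)%N; first by rewrite pq0 sqrtr0.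
rewrite muln_gt0 => /andP[p_gt0 q_gt0].
pose h (y : Kbip p q) : R := if y is inr _ then Num.sqrt p%:R else Num.sqrt q%:R.
apply: (@le_spectral_radius _ _ _ h).
  by exists (inl (Ordinal p_gt0)); rewrite /= sqrtr_eq0 -ltNge ltr0n.
rewrite natrM sqrtrM ?ler0n //.
have sqrtK (m : nat) : Num.sqrt m%:R * Num.sqrt m%:R = m%:R :> R.
  by rewrite -expr2 sqr_sqrtr ?ler0n.
case=> i; rewrite big_sumType /= big_pred0_eq sumr_ord_const.
  by rewrite add0r -mulrA sqrtK mulrC.
by rewrite addr0 mulrAC sqrtK.
Qed.

Lemma card_Dstar a n : (0 < a)%N -> (a <= n./2)%N -> #|Dstar a n| = n.
Proof. by move=> a_gt0 le_an; rewrite /Dstar !card_sum !card_ord; lia. Qed.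

(** The upper bound is [low_degree_bound] applied to [Dstar] itself at its vertex of degree [a - 1];
    the lower bound is an explicit eigenvector. *)
Lemma spectral_radius_Dstar (R : realType) (a n : nat) : (0 < a)%N -> (a <= n./2)%N ->
  spectral_radius R (Dstar a n) = Num.sqrt (Dstar_root R a n).
Proof.
move=> a_gt0 le_an; have cardD := card_Dstar a_gt0 le_an.
have D_gt0 : (0 < #|Dstar a n|)%N by rewrite cardD; lia.
have rho_ge0 := spectral_radius_ge0 R D_gt0.
apply/le_anti/andP; split.
  have [h sub_h] := spectral_radius_subinvariant R D_gt0.
  pose c (y : Dstar a n) := if y is inr _ then true else false.
  have proper_c : proper_colouring c by move=> [[?|?]|[?|?]] [[?|?]|[?|?]].
  pose v : Dstar a n := inr (inr ord0).
  have deg_v : (#|nbrs v| < a)%N.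
    rewrite /nbrs !card_set_sum /=.
    by rewrite !card_set_const !card_ord; lia.
  have [le_L _] := low_degree_bound a_gt0 le_an cardD sub_h proper_c deg_v.
  by rewrite -[leLHS]ger0_norm // -sqrtr_sqr ler_wsqrtr.
have [x0|x_gt0] := posnP (half_pred n).
  have p0 : (a - 1 = 0)%N by move: x0; rewrite /half_pred; lia.
  have -> : Dstar_root R a n = 0; last by rewrite sqrtr0.
  by rewrite /Dstar_root /Droot x0 p0 !(mulr0, subr0, expr0n, mul0r, addr0, sqrtr0).
have [tau [tau_ge0 LE tauE _]] := Dstar_root_eigen R a_gt0 le_an x_gt0.
have L_gt0 : 0 < Dstar_root R a n.
  apply: lt_le_trans (Dstar_root_ge_prod R a n); rewrite ltr0n muln_gt0 x_gt0; lia.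
pose k := Num.sqrt (Dstar_root R a n).
have k2 : k * k = Dstar_root R a n by rewrite -expr2 sqr_sqrtr ?ltW.
have k_gt0 : 0 < k by rewrite sqrtr_gt0.
pose h (y : Dstar a n) : R := match y with
  | inl (inl _) => (n./2)%:R + tau | inl (inr _) => (n./2)%:R
  | inr (inl _) => k | inr (inr _) => k * tau end.
have q_gt0 : (0 < n./2)%N by lia.
apply: (@le_spectral_radius _ _ _ h).
  by exists (inr (inl (Ordinal q_gt0))); rewrite /= gt_eqF.
have xE : (uphalf n - a)%:R = (half_pred n)%:R - (a - 1)%:R :> R.
  by rewrite -natrB /half_pred; [congr _%:R; lia | lia].
rewrite -/k => -[[i|i]|[i|i]];
  rewrite !big_sumType /= ?big_pred0_eq ?sumr_ord_const.
- by ring.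
- by ring.
- by rewrite k2 LE xE; ring.
- by rewrite mulrA k2 tauE; ring.
Qed.

(** * The bound *)

Section Certificate.

Variables (G : sgraph) (c : G -> bool) (S T : {set G}) (a b : nat).
Hypothesis proper_c : proper_colouring c.
Hypothesis sSX : forall x, x \in S -> ~~ c x.
Hypothesis sTY : forall x, x \in T -> c x.
Hypothesis cert : (b * #|S| + \sum_(v in T) #|nbrs v :\: S| < a * #|T|)%N.

Let sum_nbrs_le :
  (\sum_(v in T) #|nbrs v| <= #|S| * #|T| + \sum_(v in T) #|nbrs v :\: S|)%N.
Proof.
rewrite mulnC -sum_nat_const -big_split /=; apply: leq_sum => v _.
by rewrite -(cardsID S (nbrs v)) leq_add2r subset_leq_card // subsetIr.
Qed.

(** If all degrees were at least [a], then [a|T| <= |S||T| + e(X \ S, T) <= b|S| + e(X \ S, T)],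
    against the certificate. *)
Lemma certificate_low_degree : (#|T| <= b)%N -> exists v : G, (#|nbrs v| < a)%N.
Proof.
move=> le_Tb; case: (pickP (fun v : G => #|nbrs v| < a)%N) => [v deg_v|none]; first by exists v.
have : (a * #|T| <= \sum_(v in T) #|nbrs v|)%N.
  rewrite mulnC -sum_nat_const; apply: leq_sum => v _.
  by rewrite leqNgt; exact: negbT (none v).
have := leq_mul (leqnn #|S|) le_Tb; rewrite [(_ * b)%N]mulnC.
by move: sum_nbrs_le cert; lia.
Qed.

Lemma certificate_edges : (edges c + b * #|S| <
  #|[set x | ~~ c x]| * (#|[set y | c y]| - #|T|) + #|S| * #|T| + a * #|T|)%N.
Proof.
have sTY' : T \subset [set y | c y] by apply/subsetP => y /sTY; rewrite inE.
have edgesE : edges c = (\sum_(v in T) #|nbrs v| + \sum_(v in [set y | c y] :\: T) #|nbrs v|)%N.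
  rewrite /edges (bigID (mem T)) /=; congr (_ + _)%N; apply: eq_bigl => y.
    by case: (boolP (y \in T)) => [/sTY->|]; rewrite ?andbF.
  by rewrite !inE andbC.
have : (\sum_(v in [set y | c y] :\: T) #|nbrs v| <=
    #|[set x | ~~ c x]| * (#|[set y | c y]| - #|T|))%N.
  rewrite -{2}(setIidPr sTY') -cardsD mulnC -sum_nat_const; apply: leq_sum => y.
  rewrite !inE => /andP[_ cy]; apply: subset_leq_card; apply/subsetP => x.
  by rewrite !inE => /proper_c; rewrite cy; case: (c x).
by rewrite edgesE; move: sum_nbrs_le cert; lia.
Qed.

End Certificate.

Section Core.

Variables (R : realType) (a b n : nat) (G : sgraph).
Hypothesis a_gt0 : (0 < a)%N.
Hypothesis le_ab : (a <= b)%N.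
Hypothesis le_an : (a <= n./2)%N.
Hypothesis bipG : bipartite G.
Hypothesis cardG : #|G| = n.
Hypothesis nofactor : ~ has_factor a b G.

Local Notation rho := (spectral_radius R G).
Local Notation f := ((fab a b n)%:R : R).
Local Notation L := (Dstar_root R a n).

Lemma spectral_radius_bound : rho ^+ 2 <= Num.max f L /\
  (rho ^+ 2 = Num.max f L -> isomorphic G (Kstar a b n) \/ isomorphic G (Dstar a n)).
Proof.
have n_gt0 : (0 < n)%N by lia.
have G_gt0 : (0 < #|G|)%N by rewrite cardG.
have [h sub_h] := spectral_radius_subinvariant R G_gt0.
have [//|[c [S [T [proper_c sSX sTY cert]]]]] := factor_or_certificate le_ab bipG.
have low (v : G) : (#|nbrs v| < a)%N -> rho ^+ 2 <= Num.max f L /\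
    (rho ^+ 2 = Num.max f L -> isomorphic G (Kstar a b n) \/ isomorphic G (Dstar a n)).
  move=> deg_v; have [le_L eq_L] := low_degree_bound a_gt0 le_an cardG sub_h proper_c deg_v.
  have le_LM : L <= Num.max f L by rewrite le_max lexx orbT.
  split=> [|eq_M]; first exact: le_trans le_LM.
  by right; apply: eq_L; apply/le_anti; rewrite le_L eq_M le_LM.
have [/(certificate_low_degree cert)[v /low//]|lt_bT] := leqP #|T| b.
have le_SX : (#|S| <= #|[set x | ~~ c x]|)%N.
  by apply: subset_leq_card; apply/subsetP => x /sSX; rewrite inE.
have le_TY : (#|T| <= #|[set y | c y]|)%N.
  by apply: subset_leq_card; apply/subsetP => y /sTY; rewrite inE.
have lt_st : (b * #|S| < a * #|T|)%N by apply: leq_ltn_trans cert; exact: leq_addr.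
have cardXY := card_colours c; rewrite cardG in cardXY.
have le_prod := edges_le_prod proper_c.
have edges_le : (edges c)%:R <= Num.max f L.
  rewrite le_max.
  have [||[x_gt0]] := edge_bound a_gt0 le_ab cardXY le_SX le_TY lt_bT lt_st le_prod
    (certificate_edges proper_c sTY cert).
  - by rewrite ler_nat => ->.
  - by rewrite -(ler_nat R) => /le_trans/(_ (Dstar_root_ge_prod R a n))->; rewrite orbT.
  - by move/(Dstar_root_ge_excess R a_gt0 le_an x_gt0)->; rewrite orbT.
have rho_le := subinvariant_le_edges proper_c sub_h.
split=> [|eq_M]; first exact: le_trans edges_le.
have {}rho_le : rho ^+ 2 = (edges c)%:R by apply/le_anti; rewrite rho_le eq_M edges_le.
case: (pickP (fun v : G => #|nbrs v| < a)%N) => [v /low[_]|none]; first exact.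
have deg_ge (v : G) : (a <= #|nbrs v|)%N by rewrite leqNgt; exact: negbT (none v).
have nonisolated (v : G) : nbrs v != set0 by rewrite -cards_eq0 -lt0n (leq_trans a_gt0).
have [y yT] : exists y, y \in T by apply/card_gt0P; lia.
have rho_gt0 : 0 < rho.
  rewrite lt_neqAle spectral_radius_ge0 // andbT eq_sym; apply/eqP => rho0.
  move: rho_le; rewrite rho0 expr0n => /esym/eqP; rewrite pnatr_eq0.
  rewrite /edges (bigD1 y) ?sTY //= addn_eq0 cards_eq0.
  by rewrite (negPf (nonisolated y)).
have complete x z : ~~ c x -> c z -> adj z x.
  by move=> cx cz; apply: (subinvariant_eq_edges proper_c sub_h).
left.
have nbrsY z : c z -> nbrs z = [set x | ~~ c x].
  move=> cz; apply/setP => x; rewrite !inE; apply/idP/idP => [/proper_c|cx].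
    by rewrite cz; case: (c x).
  exact: complete.
have edgesE : edges c = (#|[set x | ~~ c x]| * #|[set y | c y]|)%N.
  rewrite /edges mulnC -sum_nat_const; apply: eq_big => z; first by rewrite inE.
  by move/nbrsY->.
have le_aX : (a <= #|[set x | ~~ c x]|)%N by rewrite -(nbrsY y (sTY _ yT)).
have lt_k : ((a + b) * #|[set x | ~~ c x]| < a * n)%N.
  have sumE : (\sum_(v in T) #|nbrs v :\: S| = #|T| * (#|[set x | ~~ c x]| - #|S|))%N.
    rewrite -sum_nat_const; apply: eq_bigr => v vT; rewrite (nbrsY v (sTY _ vT)).
    rewrite cardsD (setIidPr _) //; by apply/subsetP => x /sSX; rewrite inE.
  move: cert; rewrite sumE -cardXY => certE; rewrite mulnDr mulnDl ltn_add2l.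
  apply: leq_trans (leq_mul (leqnn a) le_TY); rewrite ltnNge; apply/negP => le_x.
  move: certE; rewrite ltnNge => /negP; apply.
  have := subnKC le_SX; move: (_ - #|S|)%N => m Em.
  (* After multiplication by [|X| = |S| + m], the inequality is the sum of [|S|] times
     [a|T| <= b|X|] and [m|T|] times [a <= |X|]. *)
  rewrite -(leq_pmul2l (leq_trans a_gt0 le_aX)); rewrite -Em in le_x le_aX *.
  have := leq_mul (leqnn #|S|) le_x.
  have := leq_mul (leqnn (m * #|T|)%N) le_aX.
  by clear; nia.
have [le_f eq_f] := fab_max a_gt0 n_gt0 le_ab lt_k.
have Ey : (n - #|[set x | ~~ c x]| = #|[set y | c y]|)%N by rewrite -cardXY addKn.
have Ex : #|[set x | ~~ c x]| = sab a b n.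
  (* The edge count attains a maximum that is at least [f], so [fab_max] holds with equality. *)
  apply/eqP; rewrite -eq_f eqn_leq le_f Ey -edgesE -(ler_nat R) -rho_le eq_M.
  by rewrite le_max lexx.
by apply: (isomorphic_Kbip proper_c complete) => //; rewrite -Ex -Ey.
Qed.

End Core.

Theorem theorem1p7 (R : realType) (a b n : nat)
    (a_gt0 : (0 < a)%N) (b_gt0 : (0 < b)%N) (n_gt0 : (0 < n)%N)
    (le_ab : (a <= b)%N) (le_an : (a <= n./2)%N)
    (G : sgraph) (bipG : bipartite G) (ordG : #|G| = n)
    (nofactor : ~ has_factor a b G) :
  [/\ spectral_radius R (Dstar a n) < Num.sqrt (fab a b n)%:R ->
        spectral_radius R G <= Num.sqrt (fab a b n)%:R /\
        (spectral_radius R G = Num.sqrt (fab a b n)%:R <->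
           isomorphic G (Kstar a b n)),
      spectral_radius R (Dstar a n) = Num.sqrt (fab a b n)%:R ->
        spectral_radius R G <= Num.sqrt (fab a b n)%:R /\
        (spectral_radius R G = Num.sqrt (fab a b n)%:R <->
           isomorphic G (Kstar a b n) \/ isomorphic G (Dstar a n))
    & Num.sqrt (fab a b n)%:R < spectral_radius R (Dstar a n) ->
        spectral_radius R G <= spectral_radius R (Dstar a n) /\
        (spectral_radius R G = spectral_radius R (Dstar a n) <->
           isomorphic G (Dstar a n))].
Proof.
have [le_M eq_M] := spectral_radius_bound R a_gt0 le_ab le_an bipG ordG nofactor.
have lt_sn := sab_lt_half a_gt0 n_gt0 le_ab.
have rhoK : spectral_radius R (Kstar a b n) = Num.sqrt (fab a b n)%:R.
  by apply: spectral_radius_Kbip; lia.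
have rhoD := spectral_radius_Dstar R a_gt0 le_an.
have isoK : isomorphic G (Kstar a b n) -> spectral_radius R G = Num.sqrt (fab a b n)%:R.
  by move/(spectral_radius_isomorphic R)->.
have isoD : isomorphic G (Dstar a n) -> spectral_radius R G = spectral_radius R (Dstar a n).
  exact: spectral_radius_isomorphic.
have rho_ge0 : 0 <= spectral_radius R G by apply: spectral_radius_ge0; rewrite ordG.
have f_ge0 : 0 <= (fab a b n)%:R :> R by exact: ler0n.
have L_ge0 : 0 <= Dstar_root R a n.
  by apply: le_trans (Dstar_root_ge_prod R a n); exact: ler0n.
set rho := spectral_radius R G in le_M eq_M isoK isoD rho_ge0 *.
have maxE : Num.sqrt (Num.max (fab a b n)%:R (Dstar_root R a n)) =
    Num.max (Num.sqrt (fab a b n)%:R) (spectral_radius R (Dstar a n)).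
  rewrite rhoD; have [le_fL|/ltW le_Lf] := leP (fab a b n)%:R (Dstar_root R a n).
    by rewrite (max_idPr _) // ler_wsqrtr.
  by rewrite (max_idPl _) // ler_wsqrtr.
have rho_le : rho <= Num.max (Num.sqrt (fab a b n)%:R) (spectral_radius R (Dstar a n)).
  by rewrite -maxE -[leLHS]ger0_norm // -sqrtr_sqr ler_wsqrtr.
have rho_eq : rho = Num.max (Num.sqrt (fab a b n)%:R) (spectral_radius R (Dstar a n)) ->
    isomorphic G (Kstar a b n) \/ isomorphic G (Dstar a n).
  by rewrite -maxE => rhoE; apply: eq_M; rewrite rhoE sqr_sqrtr // le_max f_ge0.
split=> cmp; move: rho_le rho_eq.
(* Each case says which term attains the maximum; a strict comparison excludes the other extremal
   graph. *)
- rewrite (max_idPl (ltW cmp)) => rho_le rho_eq; split=> //.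
  split=> [/[dup] rhoE /rho_eq[//|/isoD rhoE']|//].
  by move: cmp; rewrite -rhoE -rhoE' ltxx.
- rewrite cmp maxxx => rho_le rho_eq; split=> //; split=> // -[|/isoD->//].
  exact: isoK.
rewrite (max_idPr (ltW cmp)) => rho_le rho_eq; split=> //.
split=> [/[dup] rhoE /rho_eq[/isoK rhoE'|//]|//].
by move: cmp; rewrite -rhoE -rhoE' ltxx.
Qed.
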